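(* A partial function $F:\subseteq\mathbb{N}^{\mathbb{N}}\to\mathbb{N}^{\mathbb{N}}$ is computable relative to the halting problem if and only if there is a computable function $G:\subseteq\mathbb{N}^{\mathbb{N}}\to\mathbb{N}^{\mathbb{N}}$ such that $F=G\circ\mathsf{H}$, where $\mathsf{H}:=\mathsf{J}\circ\lim^{-1}:\mathbb{N}^{\mathbb{N}}\rightrightarrows\mathbb{N}^{\mathbb{N}}$.
   Context: $F:\subseteq A\to B$ denotes a partial function, $f:\subseteq A\rightrightarrows B$ a partial multi-valued function (with $f(a)\neq\emptyset$ for $a\in\mathrm{dom}(f)$). The composition of multi-valued functions $f:\subseteq X\rightrightarrows Y$, $g:\subseteq Y\rightrightarrows Z$ is $(g\circ f)(x):=\{z\in Z:(\exists y\in f(x))\;z\in g(y)\}$ with $\mathrm{dom}(g\circ f):=\{x\in\mathrm{dom}(f): f(x)\subseteq\mathrm{dom}(g)\}$. Single-valued functions are identified with multi-valued functions whose values are singletons. Coding: $\langle n,k\rangle:=\frac12(n+k)(n+k+1)+k$ for $n,k\in\mathbb{N}$; $\langle p,q\rangle(2n):=p(n)$, $\langle p,q\rangle(2n+1):=q(n)$; $\langle p_0,p_1,p_2,\dots\rangle\langle n,k\rangle:=p_n(k)$ for $p,q,p_i\in\mathbb{N}^{\mathbb{N}}$. A partial function $F:\subseteq\mathbb{N}^{\mathbb{N}}\to\mathbb{N}^{\mathbb{N}}$ is computable if there is a Turing machine (infinite input tape, one-way output tape) that on each input $p\in\mathrm{dom}(F)$ produces $F(p)$ in the long run; nothing is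 required outside $\mathrm{dom}(F)$. $F$ is computable relative to $q\in\mathbb{N}^{\mathbb{N}}$ if there is a computable $G:\subseteq\mathbb{N}^{\mathbb{N}}\to\mathbb{N}^{\mathbb{N}}$ with $F(p)=G\langle q,p\rangle$ for all $p\in\mathrm{dom}(F)$. The limit map is $\lim:\subseteq\mathbb{N}^{\mathbb{N}}\to\mathbb{N}^{\mathbb{N}}$, $\langle p_0,p_1,\dots\rangle\mapsto\lim_{i\to\infty}p_i$ (product topology); $\lim^{-1}(p)=\{r:\lim(r)=p\}$. The Turing jump $\mathsf{J}:\mathbb{N}^{\mathbb{N}}\to\mathbb{N}^{\mathbb{N}}$ is defined by $\mathsf{J}(p)(i)=1$ if the $i$-th Turing machine halts upon input $p$, and $\mathsf{J}(p)(i)=0$ otherwise. Thus $\mathsf{H}(p)=\{\mathsf{J}(r):\lim(r)=p\}$. The halting problem is $0':=\mathsf{J}(000\dots)$. *)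

(* Defs.v *)
From mathcomp Require Import all_boot all_classical topology.

Set Implicit Arguments.
Unset Strict Implicit.
Unset Printing Implicit Defensive.

Local Open Scope classical_set_scope.

(** * Multi-valued and partial functions *)

(* A partial multi-valued function is the map sending x to its set of values;
   x is outside the domain exactly when this set is empty. *)
Notation mfun X Y := (X -> set Y) (only parsing).

Definition mdom X Y (f : mfun X Y) : set X := [set x | f x !=set0].

(* As for composition of problems, x is in the domain only if every value of
   [f] at x is in the domain of [g]. *)
Definition mcomp X Y Z (g : mfun Y Z) (f : mfun X Y) : mfun X Z :=
  fun x => [set z | f x `<=` mdom g /\ exists2 y, f x y & g y z].

Definition minv X Y (f : mfun X Y) : mfun Y X := fun y => [set x | f x y].

Definition mfun_of_fun X Y (f : X -> Y) : mfun X Y := fun x => [set f x].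

Record pfun (X Y : Type) := PFun {
  pfun_graph :> mfun X Y;
  pfun_single_valued : forall x, is_subset1 (pfun_graph x) }.

Lemma mdom_mcomp X Y Z (g : mfun Y Z) (f : mfun X Y) :
  mdom (mcomp g f) = [set x | mdom f x /\ f x `<=` mdom g].
Proof.
apply/seteqP; split=> x [].
  by move=> z [fg [y fxy _]]; split=> //; exists y.
by move=> [y fxy] fg; have [z gyz] := fg _ fxy; exists z; split=> //; exists y.
Qed.

(** * Baire space and its codings *)

Definition baire := {ptws nat -> nat}.

Definition npair (n k : nat) : nat := ((n + k) * (n + k).+1)./2 + k.

Definition bpair (p q : baire) : baire :=
  fun m => if odd m then q m./2 else p m./2.

(* [component r n] is p_n when r = <p_0, p_1, ...>; [npair] being bijective,
   every r is of this form. *)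
Definition component (r : baire) (n : nat) : baire := fun k => r (npair n k).

Definition limit : mfun baire baire :=
  fun r => [set p | component r @ \oo --> p].

(** * Turing machines on infinite inputs *)

(* A sequence p is written on a tape as the infinite binary word
   1^(p 0) 0 1^(p 1) 0 ..., whose n-th letter is [unary p n]. *)
Definition unary (p : baire) (n : nat) : bool :=
  nth false (flatten [seq rcons (nseq (p i) true) false | i <- iota 0 n.+1]) n.

(* The leftmost cell of the input tape carries the end marker [None]. *)
Definition input_cell (p : baire) (n : nat) : option bool :=
  if n is m.+1 then Some (unary p m) else None.

Inductive move := Left | Stay | Right.

(* Tapes are infinite to the right only; a left move from cell 0 is void. *)
Definition shift (d : move) (n : nat) : nat :=
  match d with Left => n.-1 | Stay => n | Right => n.+1 end.

(* In state [t_state], with the input head scanning [t_in] and the work head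
   scanning [t_work]: go to state [t_next], write [t_write] on the work tape,
   move the two heads, and append the letter in [t_emit], if any, to the
   output. *)
Record transition := Transition {
  t_state : nat; t_in : option bool; t_work : nat;
  t_next : nat; t_write : nat; t_imove : move; t_wmove : move;
  t_emit : option bool }.

(* A machine is its finite transition table, of which the first applicable
   entry is used; the finite sets of states and of work symbols are those
   occurring in the table, together with the initial state 0 and the
   blank 0. *)
Definition machine := seq transition.

(* The cells of the work tape beyond the end of [wtape] are blank. *)
Record config := Config {
  state : nat; ihead : nat; whead : nat; wtape : seq nat; output : seq bool }.

Definition init : config := Config 0 0 0 [::] [::].

Definition applicable (p : baire) (c : config) (t : transition) : bool :=
  [&& t_state t == state c, t_in t == input_cell p (ihead c)
    & t_work t == nth 0 (wtape c) (whead c)].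

Definition apply (t : transition) (c : config) : config :=
  Config (t_next t) (shift (t_imove t) (ihead c)) (shift (t_wmove t) (whead c))
    (set_nth 0 (wtape c) (whead c) (t_write t))
    (if t_emit t is Some b then rcons (output c) b else output c).

Definition step (M : machine) (p : baire) (c : config) : option config :=
  omap (apply^~ c) (ohead [seq t <- M | applicable p c t]).

(* [None] means that the machine halted after fewer than [n] steps. *)
Definition run (M : machine) (p : baire) (n : nat) : option config :=
  iter n (obind (step M p)) (Some init).

Definition halts (M : machine) (p : baire) : Prop := exists n, run M p n = None.

Definition produces (M : machine) (p q : baire) : Prop :=
  forall k, exists n c,
    run M p n = Some c /\ onth (output c) k = Some (unary q k).

Definition computable (F : pfun baire baire) : Prop :=
  exists M, forall p q, F p q -> produces M p q.

Definition computable_relative_to (q : baire) (F : pfun baire baire) : Prop :=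
  exists2 G : pfun baire baire, computable G &
    forall p, mdom F p -> F p = G (bpair q p).

(** * The numbering of Turing machines and the jump *)

Definition letter_of_nat (n : nat) : option bool :=
  match n with 0 => None | 1 => Some false | _ => Some true end.

Definition move_of_nat (n : nat) : move :=
  match n with 0 => Stay | 1 => Left | _ => Right end.

Definition transition_of_seq (s : seq nat) : transition :=
  let a := nth 0 s in
  Transition (a 0) (letter_of_nat (a 1)) (a 2) (a 3) (a 4)
    (move_of_nat (a 5)) (move_of_nat (a 6)) (letter_of_nat (a 7)).

(* [CodeSeq.decode] is the library's computable bijection from [nat] to
   [seq nat]. *)
Definition machine_of_nat (i : nat) : machine :=
  [seq transition_of_seq (CodeSeq.decode n) | n <- CodeSeq.decode i].

Lemma machine_of_nat_surj (M : machine) : exists i, machine_of_nat i = M.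
Proof.
pose lett (b : option bool) := if b is Some b then (b : nat).+1 else 0.
pose mv d := match d with Stay => 0 | Left => 1 | Right => 2 end.
pose enc t := CodeSeq.code [:: t_state t; lett (t_in t); t_work t; t_next t;
  t_write t; mv (t_imove t); mv (t_wmove t); lett (t_emit t)].
exists (CodeSeq.code (map enc M)).
rewrite /machine_of_nat CodeSeq.codeK -map_comp -[RHS]map_id.
apply: eq_map => t /=; rewrite CodeSeq.codeK /transition_of_seq /=.
by case: t => ? [[]|] ? ? ? [] [] [[]|].
Qed.

Definition jump (p : baire) : baire :=
  fun i => if `[< halts (machine_of_nat i) p >] then 1 else 0.

Definition halting_problem : baire := jump (fun=> 0).

Definition jump_limit_inv : mfun baire baire :=
  mcomp (mfun_of_fun jump) (minv limit).

(* Main.v *)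
(* If [lim r = p], then [p] and [0'] can be computed from [J r]: the value [p k] is
   the first [v] found, together with some [n], such that the search for an
   [i >= n] with [r_i k <> v] does not halt; and [0'] is reducible to [J r]. This
   gives [G] from a function that is computable relative to [0'], as [J] is
   injective.

   Conversely, a sequence [r] with [lim r = p] is built from [p] and [0'] by finite
   extensions, in such a way that [J r] is computed along with it. Stage [n] asks
   [0'] whether the current finite sequence has an extension on which machine [n]
   halts, among those whose new entries in columns [k < n] equal [p k]; if so, the
   first such extension is taken, otherwise machine [n] does not halt on [r]. Then
   [F p = G (J r)].

   The machines are obtained by compiling while programs. The programs compute on
   codes of lists, pairs and machines, and the parameter of a query to a jump is
   stored in a machine by a prologue that writes it on the work tape. *)

From HB Require Import structures.
From mathcomp Require Import all_boot all_classical topology.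
From mathcomp Require Import zify.
Require Import Defs.

Set Implicit Arguments.
Unset Strict Implicit.
Unset Printing Implicit Defensive.

(** * While programs with input and output *)

(** The constant sequence $\langle p,p,\dots\rangle$ also has limit [p], but its jump computes the
    jump of [p], which [p] and [0'] need not compute. Hence the sequence of the converse has to be
    generic, as in Friedberg's jump inversion. Restraining only the columns below [n] at stage [n]
    keeps each question finite: its data are [n], the current sequence and [n] values of [p]. Every
    column is restrained from some stage on, which forces the limit.

    Both directions have one shape, isolated in [transfer]: a sequence [b] is found value by value
    from finite parts of an oracle and from the earlier values of [b], while a given machine is
    simulated on it. The earlier values matter because each stage starts from the sequence that the
    previous stage left.

    A question to a jump is the number of a machine, and this number must be computable from the
    data of the question. This is an s-m-n theorem for concrete transition tables. *)

Inductive cmd :=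
  | Skip | Inc of nat | Dec of nat | Read of nat | Emit of bool
  | Seq of cmd & cmd | If of nat & cmd & cmd | While of nat & cmd.

HB.instance Definition _ := gen_eqMixin cmd.

Definition store := nat -> nat.

Definition upd (T : Type) (s : nat -> T) (r : nat) (v : T) : nat -> T :=
  fun x => if x == r then v else s x.

Record conf := Conf
  { stack : seq cmd; regs : store; nread : nat; emitted : seq bool }.

(** [Read] leaves its increment on the stack as an [Inc]: a machine can then remember the letter in
    its state until it has found the register on its tape. *)
Definition cstep (p : baire) (c : cmd) (k : seq cmd) (s : store) (i : nat)
    (o : seq bool) : conf :=
  match c with
  | Skip => Conf k s i o
  | Inc r => Conf k (upd s r (s r).+1) i o
  | Dec r => Conf k (upd s r (s r).-1) i o
  | Read r => Conf (if unary p i then Inc r :: k else k) s i.+1 o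
  | Emit b => Conf k s i (rcons o b)
  | Seq c d => Conf (c :: d :: k) s i o
  | If r c d => Conf ((if s r == 0 then d else c) :: k) s i o
  | While r c => Conf (if s r == 0 then k else c :: While r c :: k) s i o
  end.

Fixpoint maxreg (c : cmd) : nat :=
  match c with
  | Skip | Emit _ => 0
  | Inc r | Dec r | Read r => r
  | Seq c d => maxn (maxreg c) (maxreg d)
  | If r c d => maxn r (maxn (maxreg c) (maxreg d))
  | While r c => maxn r (maxreg c)
  end.

(* All the stacks that can occur while [c] is executed on top of [k]. *)
Fixpoint stacks (c : cmd) (k : seq cmd) : seq (seq cmd) :=
  (c :: k) :: match c with
    | Read r => [:: Inc r :: k]
    | Seq c d => stacks c (d :: k) ++ stacks d k
    | If _ c d => stacks c k ++ stacks d k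
    | While r c' => stacks c' (c :: k)
    | _ => [::]
    end.

Lemma stacks_head c k : c :: k \in stacks c k.
Proof. by case: c => *; rewrite inE eqxx. Qed.

(** The machine keeps the stack of the program in its state; by this closure property finitely many
    states are enough. *)
Lemma stacks_step p c k c' k' s i o : c' :: k' \in stacks c k ->
  stack (cstep p c' k' s i o) \in k :: stacks c k.
Proof.
elim: c k => [|r|r|r|b|c IHc d IHd|r c IHc d IHd|r c IHc] k /=;
  rewrite in_cons => /orP[/eqP[-> ->]|] //=.
all: try by rewrite inE eqxx.
- by case: ifP; rewrite !inE eqxx ?orbT.
- by rewrite inE => /eqP[-> ->] /=; rewrite !inE eqxx ?orbT.
- by rewrite !inE mem_cat stacks_head !orbT.
- rewrite mem_cat => /orP[/IHc|/IHd]; rewrite !inE mem_cat => /orP[/eqP->|->];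
    by rewrite ?eqxx ?stacks_head ?orbT.
- by case: ifP => _; rewrite !inE mem_cat stacks_head !orbT.
- rewrite mem_cat => /orP[/IHc|/IHd]; rewrite !inE mem_cat => /orP[/eqP->|->];
    by rewrite ?eqxx ?orbT.
- by case: ifP => _; rewrite !inE ?eqxx ?stacks_head ?orbT.
- by move=> /IHc; rewrite !inE => /orP[/eqP->|->]; rewrite ?eqxx ?orbT.
Qed.

Lemma stacks_maxreg K c k k' : k' \in stacks c k ->
  maxreg c < K -> all (fun c => maxreg c < K) k ->
    all (fun c => maxreg c < K) k'.
Proof.
elim: c k k' => [|r|r|r|b|c IHc d IHd|r c IHc d IHd|r c IHc] k k' /=;
  rewrite in_cons => /orP[/eqP->/= -> -> //|] //=.
- by rewrite inE => /eqP-> /= -> ->.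
- rewrite mem_cat gtn_max => /orP[/IHc|/IHd] /= H /andP[c1 d1] k1; apply: H =>
  //=.
  by rewrite d1.
- rewrite mem_cat !gtn_max => /orP[/IHc|/IHd] /= H /and3P[r1 c1 d1] k1;
  exact: H.
- rewrite gtn_max => /IHc /= H /andP[r1 c1] k1; apply: H => //.
  by rewrite /= gtn_max r1 c1.
Qed.

(** * Turing machines of while programs *)

(** A command starts with the work head on cell 0. In phase [Go] it is carried out, if necessary
    after a search to the right for a register; [Put r] drops register [r] on the cell reached after
    its removal; [Ret] brings the head back to cell 0. *)
Inductive phase := Go | Ret | Put of nat.

HB.instance Definition _ := gen_eqMixin phase.

(* Symbols are sets of registers: cell [j] of the work tape holds the registers
   of value [j]. Register [K] is constantly [0], and marks the leftmost cell. *)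
Definition symbol K := {set 'I_K.+1}.

(** The empty set needs the code 0 of the blank, since all but finitely many cells hold no
    register. *)
Definition symbol_code K (a : symbol K) : nat :=
  if a == finset.set0 then 0 else (enum_rank a).+1.

Lemma symbol_code_inj K : injective (@symbol_code K).
Proof.
move=> a b; rewrite /symbol_code; case: eqP => [->|_]; case: eqP => [->|_] //.
by move=> [] /ord_inj /enum_rank_inj.
Qed.

Definition tm_state := (seq cmd * phase)%type.

Record action K := Action { a_next : tm_state; a_write : symbol K;
  a_imove : bool; a_wmove : move; a_emit : option bool }.

Definition delta K (q : tm_state) (b : bool) (a : symbol K) :
  option (action K) :=
  match q.2 with
  | Put r => Some (Action (q.1, Ret) (inord r |: a)%SET false Stay None)
  | Ret => Some (if ord_max \in a then Action (q.1, Go) a false Stay None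
                 else Action (q.1, Ret) a false Left None)
  | Go => if q.1 isn't c :: k then None else Some
    match c with
    | Skip => Action (k, Go) a false Stay None
    | Inc r => if inord r \in a
        then Action (k, Put r) (a :\ inord r)%SET false Right None
        else Action (c :: k, Go) a false Right None
    | Dec r => if inord r \in a
        then Action (k, Put r) (a :\ inord r)%SET false Left None
        else Action (c :: k, Go) a false Right None
    | Read r => Action (if b then Inc r :: k else k, Go) a true Stay None
    | Emit e => Action (k, Go) a false Stay (Some e)
    | Seq c d => Action (c :: d :: k, Go) a false Stay None
    | If r c d => Action ((if inord r \in a then d else c) :: k, Go) a
                    false Stay None
    | While r c' => Action (if inord r \in a then k else c' :: c :: k, Go) a
                     false Stay None
    end
  end.

Definition tm_states K (c : cmd) : seq tm_state :=
  [seq (k, f) | k <- [::] :: stacks c [::], f <- Go :: Ret :: map Put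
    (iota 0 K)].

(* Even states are left free for a prologue. *)
Definition state_code K c (q : tm_state) : nat :=
  (index q (tm_states K c)).*2.+1.

Lemma state_code_inj K c : {in tm_states K c &, injective (state_code K c)}.
Proof. by move=> q q' qS q'S /succn_inj/double_inj; apply: index_inj. Qed.

Definition table_entry K c (q : tm_state) (x : bool * symbol K) :
    option transition :=
  omap (fun t => Transition (state_code K c q) (Some x.1) (symbol_code x.2)
    (state_code K c (a_next t)) (symbol_code (a_write t))
    (if a_imove t then Right else Stay) (a_wmove t) (a_emit t))
  (delta q x.1 x.2).

Definition table K c : machine :=
  pmap id [seq table_entry c q x | q <- tm_states K c,
    x <- enum {: bool * symbol K}].

Lemma ohead_filter (T : eqType) (P : pred T) (s : seq T) x :
  x \in s -> P x -> {in s, forall y, P y -> y = x} ->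
    ohead [seq y <- s | P y] = Some x.
Proof.
move=> xs Px H; have: x \in [seq y <- s | P y] by rewrite mem_filter Px.
have: all (pred1 x) [seq y <- s | P y].
  by apply/allP => y; rewrite mem_filter => /andP[Py /H ->] /=.
by case: [seq y <- s | P y] => //= y l /andP[/eqP-> _].
Qed.

HB.instance Definition _ := gen_eqMixin transition.

Lemma tableP K c t : reflect
  (exists q x, [/\ q \in tm_states K c & @table_entry K c q x = Some t])
  (t \in table K c).
Proof.
apply: (iffP idP).
  rewrite /table mem_pmap map_id => /allpairsP[[q x] [/= qS _ E]].
  by exists q, x; split.
move=> [q [x [qS E]]]; rewrite /table mem_pmap map_id -E.
by apply: allpairs_f => //; rewrite mem_enum.
Qed.

(** The input head is at [i.+1] after [i] letters because cell 0 holds the end marker, which only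
    the prologue scans. *)
Record represents K c (q : tm_state) (h : nat) (T : nat -> symbol K) (i : nat)
    (o : seq bool) (d : config) : Prop := Represents {
  rep_state : state d = state_code K c q;
  rep_whead : whead d = h;
  rep_ihead : ihead d = i.+1;
  rep_output : output d = o;
  rep_tape : forall j, nth 0 (wtape d) j = symbol_code (T j) }.

Definition prologue_free (pre : machine) := all (fun t => ~~ odd (t_state t))
  pre.

Lemma filter_prologue pre p d : prologue_free pre -> odd (state d) ->
  [seq t <- pre | applicable p d t] = [::].
Proof.
move=> pre0 od; apply/eqP; rewrite -(negbK (_ == _)) -has_filter.
apply/hasPn => t /(allP pre0); apply: contra => /and3P[/eqP E _ _].
by rewrite E.
Qed.

Lemma tm_step K c pre p q h T i o d (t : action K) :
  prologue_free pre -> q \in tm_states K c ->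
  represents c q h T i o d -> delta q (unary p i) (T h) = Some t ->
  exists d', step (pre ++ table K c) p d = Some d' /\
    represents c (a_next t) (shift (a_wmove t) h) (upd T h (a_write t))
      (if a_imove t then i.+1 else i)
      (if a_emit t is Some b then rcons o b else o) d'.
Proof.
move=> pre0 qS [E1 E2 E3 E4 E5] D.
pose tr := Transition (state_code K c q) (Some (unary p i)) (symbol_code (T h))
    (state_code K c (a_next t)) (symbol_code (a_write t))
    (if a_imove t then Right else Stay) (a_wmove t) (a_emit t).
exists (apply tr d); split.
  rewrite /step filter_cat.
  rewrite filter_prologue ?E1 /= ?odd_double //.
  rewrite /= (_ : ohead _ = Some tr) //; apply: ohead_filter.
  - by apply/tableP; exists q, (unary p i, T h); rewrite /table_entry /= D.
  - by rewrite /applicable /= E1 E2 E3 E5 !eqxx.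
  - move=> t' /tableP[q' [x [qS']]]; rewrite /table_entry.
    case D': (delta _ _ _) => [t''|] //= [<-].
    rewrite /applicable /= E1 E2 E3 E5 => /and3P[/eqP] I.
    have {}I : q' = q by apply: state_code_inj I.
    move=> /eqP[xi] /eqP/symbol_code_inj xT; rewrite I xi xT D in D'.
    by case: D' => <-; rewrite /tr I xi xT.
split => //=; rewrite ?E2 ?E3 ?E4 //.
  by case: (a_imove t).
move=> j; rewrite nth_set_nth /= /upd; by case: eqP.
Qed.

Lemma tm_halt K c pre p h (T : nat -> symbol K) i o d :
  prologue_free pre -> represents c ([::], Go) h T i o d ->
  step (pre ++ table K c) p d = None.
Proof.
move=> pre0 [E1 E2 E3 E4 E5]; rewrite /step filter_cat.
rewrite filter_prologue ?E1 /= ?odd_double //.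
rewrite (_ : [seq t <- table K c | applicable p d t] = [::]) //.
apply/eqP; rewrite -(negbK (_ == _)) -has_filter; apply/hasPn => t0.
move=> /tableP[q' [x [qS']]]; rewrite /table_entry.
case D': (delta _ _ _) => [t''|] //= [<-].
apply/negP; rewrite /applicable /= E1 => /and3P[/eqP] I _ _.
have {}I : q' = ([::], Go).
  apply: (state_code_inj qS' _ I).
  by apply/allpairsP; exists ([::], Go); rewrite /= !inE !eqxx.
by rewrite I in D'.
Qed.

Definition steps (T : Type) (f : T -> option T) (n : nat) (x y : T) : Prop :=
  iter n (obind f) (Some x) = Some y.

Lemma steps0 T (f : T -> option T) x : steps f 0 x x.
Proof. by []. Qed.

Lemma steps_trans T (f : T -> option T) m n x y z :
  steps f m x y -> steps f n y z -> steps f (m + n) x z.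
Proof. by rewrite /steps addnC iterD => ->. Qed.

Lemma steps1 T (f : T -> option T) n x y z :
  f x = Some y -> steps f n y z -> steps f n.+1 x z.
Proof. by rewrite -[n.+1]add1n => fx; apply: steps_trans. Qed.

Definition cnext (p : baire) (x : conf) : option conf :=
  if stack x is c :: k then Some (cstep p c k (regs x) (nread x) (emitted x))
  else None.

Definition tape_of K (s : store) (j : nat) : symbol K :=
  [set r : 'I_K.+1 | s r == j]%SET.

Lemma in_tape_of K s j r : r < K -> (inord r \in tape_of K s j) = (s r == j).
Proof. by move=> rK; rewrite inE inordK // ltnW. Qed.

Lemma ord_max_tape_of K s j : (ord_max \in tape_of K s j) = (s K == j).
Proof. by rewrite inE. Qed.

Definition home K c (x : conf) (d : config) : Prop :=
  [/\ stack x \in [::] :: stacks c [::], regs x K = 0 &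
    represents c (stack x, Go) 0 (tape_of K (regs x)) (nread x) (emitted x) d].

Lemma tm_states_Go K c k : k \in [::] :: stacks c [::] ->
  (k, Go) \in tm_states K c.
Proof. by move=> kS; apply: (allpairs_f pair kS); rewrite inE eqxx. Qed.

Lemma tm_states_Ret K c k : k \in [::] :: stacks c [::] ->
  (k, Ret) \in tm_states K c.
Proof. by move=> kS; apply: (allpairs_f pair kS); rewrite !inE eqxx orbT. Qed.

Lemma tm_states_Put K c k r :
  k \in [::] :: stacks c [::] -> r < K -> (k, Put r) \in tm_states K c.
Proof.
move=> kS rK; apply: (allpairs_f pair kS); rewrite !inE.
by apply/orP; right; apply/orP; right; apply: map_f; rewrite mem_iota.
Qed.

Lemma represents_ext K c q h (T T' : nat -> symbol K) i o d :
  T =1 T' -> represents c q h T i o d -> represents c q h T' i o d.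
Proof. by move=> E [E1 E2 E3 E4 E5]; split => // j; rewrite -E. Qed.

Lemma tm_return K c pre p k s h i o d :
  prologue_free pre -> k \in [::] :: stacks c [::] -> s K = 0 ->
  represents c (k, Ret) h (tape_of K s) i o d ->
  exists n d', steps (step (pre ++ table K c) p) n d d' /\
    home K c (Conf k s i o) d'.
Proof.
move=> pre0 kS sK; elim: h d => [|h IH] d R.
  have D : delta (k, Ret) (unary p i) (tape_of K s 0) =
      Some (Action (k, Go) (tape_of K s 0) false Stay None).
    by rewrite /delta ord_max_tape_of sK.
  have [d' [E R']] := tm_step pre0 (tm_states_Ret K kS) R D.
  exists 1, d'; split => //; split => //; apply: represents_ext R' => j.
  by rewrite /upd /=; case: eqP => // ->.
have D : delta (k, Ret) (unary p i) (tape_of K s h.+1) =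
    Some (Action (k, Ret) (tape_of K s h.+1) false Left None).
  by rewrite /delta ord_max_tape_of sK.
have [d' [E R']] := tm_step pre0 (tm_states_Ret K kS) R D.
have [|n [d'' [E' R'']]] := IH d'.
  apply: represents_ext R' => j.
  by rewrite /upd /=; case: eqP => // ->.
by exists n.+1, d''; split => //; apply: steps1 E'.
Qed.

(** The register is dropped on the tape [T] from which it has already been removed, so the case
    [v = s r], a decrement of 0, is included. *)
Lemma tape_of_upd K s r v : r < K ->
  let T := upd (tape_of K s) (s r) (tape_of K s (s r) :\ inord r)%SET in
  upd T v (inord r |: T v)%SET =1 tape_of K (upd s r v).
Proof.
move=> rK T j; apply/setP => x; rewrite [RHS]inE /T /upd.
have xr : (x == inord r) = (x == r :> nat) by rewrite -val_eqE /= inordK //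
  ltnW.
have inU (A : symbol K) : (x \in (inord r |: A)%SET) = (x == r :> nat) ||
  (x \in A).
  by rewrite finset.in_setU1 xr.
have inD (A : symbol K) : (x \in (A :\ inord r)%SET) = (x != r :> nat) &&
  (x \in A).
  by rewrite finset.in_setD1 xr.
have [xr'|xr'] := eqVneq (x : nat) r; last first.
  by case: (j =P v) => [->|_]; [case: (v =P s r) => [->|_]|case: (j =P s r) =>
    [->|_]];
    rewrite ?inU ?inD ?(negbTE xr') ?inE.
case: (j =P v) => [->|jv]; first by rewrite inU xr' !eqxx.
rewrite [RHS](introF eqP) => [|/esym //].
case: (j =P s r) => [_|js]; first by rewrite inD xr' eqxx.
by rewrite inE xr'; apply/eqP => /esym.
Qed.

(* Shared by [Inc] and [Dec], of which [m] is the final move to the new value. *)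
Lemma tm_update K c pre p k c' r s h i o d (m : move) :
  prologue_free pre -> c' :: k \in [::] :: stacks c [::] ->
  k \in [::] :: stacks c [::] -> r < K -> s K = 0 ->
  (forall a, delta (c' :: k, Go) (unary p i) a = Some (if inord r \in a
        then Action (k, Put r) (a :\ inord r)%SET false m None
        else Action (c' :: k, Go) a false Right None) :> option (action K)) ->
  h <= s r ->
  represents c (c' :: k, Go) h (tape_of K s) i o d ->
  exists n d', steps (step (pre ++ table K c) p) n.+1 d d' /\
    home K c (Conf k (upd s r (shift m (s r))) i o) d'.
Proof.
(* Induction on the distance from the head to the cell that holds the register. *)
move=> pre0 ckS kS rK sK D; move e: (s r - h) => e'; elim: e' h d e =>
  [|e' IH] h d e hs R.
  have {hs e} hE : h = s r by lia.
  rewrite hE in R.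
  have D1 := D (tape_of K s (s r)); rewrite in_tape_of // eqxx in D1.
  have [d1 [E1 R1]] := tm_step pre0 (tm_states_Go K ckS) R D1.
  have D2 a : delta (k, Put r) (unary p i) a =
      Some (Action (k, Ret) (inord r |: a)%SET false Stay None) :> option
        (action K).
    by [].
  have [d2 [E2 R2]] := tm_step pre0 (tm_states_Put kS rK) R1 (D2 _).
  have [//|||n [d3 [E3 R3]]] :=
      @tm_return K c pre p k (upd s r (shift m (s r))) (shift m (s r)) i o d2
        pre0.
  - by rewrite /upd; case: eqP => // E; lia.
  - by apply: represents_ext R2; exact: tape_of_upd.
  exists n.+1, d3; split => //; apply: steps1 E1 _; exact: steps1 E2 E3.
have D1 := D (tape_of K s h); rewrite in_tape_of // ifF in D1;
  last by apply/eqP; lia.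
have [d' [E R']] := tm_step pre0 (tm_states_Go K ckS) R D1.
have [|||n [d'' [E' R'']]] := IH h.+1 d'; try lia.
  by apply: represents_ext R' => j; rewrite /upd /=; case: eqP => // ->.
by exists n.+1, d''; split => //; apply: steps1 E'.
Qed.

(** At least one machine step per program step, so that a program that runs for ever gives a machine
    that never halts. *)
Lemma tm_cnext K c pre p x y d :
  prologue_free pre -> maxreg c < K -> cnext p x = Some y -> home K c x d ->
  exists n d', steps (step (pre ++ table K c) p) n.+1 d d' /\ home K c y d'.
Proof.
move=> pre0 cK; case: x => -[|c' k] s i o //= [<-] [/= kS sK R].
have kS' : c' :: k \in stacks c [::] by move: kS; rewrite inE.
have /= yS := stacks_step p s i o kS'.
have := stacks_maxreg kS' cK isT => /= /andP[c'K kK].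
(* All commands except [Inc] and [Dec] take a single transition, which leaves the work tape
   unchanged. *)
have other (t : action K) : delta (c' :: k, Go) (unary p i) (tape_of K s 0) =
  Some t ->
    let y := cstep p c' k s i o in
    a_next t = (stack y, Go) -> a_write t = tape_of K s 0 -> a_wmove t = Stay ->
    (if a_imove t then i.+1 else i) = nread y ->
    (if a_emit t is Some b then rcons o b else o) = emitted y -> regs y = s ->
    exists n d', steps (step (pre ++ table K c) p) n.+1 d d' /\ home K c y d'.
  move=> D y' E1 E2 E3 E4 E5 E6.
  have [d' [E R']] := tm_step pre0 (tm_states_Go K kS) R D.
  exists 0, d'; split => //; split => //; rewrite ?E6 //.
  rewrite E1 E2 E3 E4 E5 in R'; apply: represents_ext R' => j.
  by rewrite /upd /=; case: eqP => // ->.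
case: c' => [|r|r|r|b|c1 c2|r c1 c2|r c1] in kS kS' R yS c'K other *.
- exact: (other _ erefl).
- apply: (@tm_update _ _ _ _ _ (Inc r) r s 0 i o d Right pre0) => //.
(* On cell 0 the left move is void, in agreement with [0.-1 = 0]. *)
- apply: (@tm_update _ _ _ _ _ (Dec r) r s 0 i o d Left pre0) => //.
- exact: (other _ erefl).
- exact: (other _ erefl).
- exact: (other _ erefl).
- apply: (other _ erefl) => //=. 
  by rewrite in_tape_of ?(leq_ltn_trans _ c'K) //= leq_maxl.
- apply: (other _ erefl) => //=. 
  by rewrite in_tape_of ?(leq_ltn_trans _ c'K) //= leq_maxl.
Qed.

Lemma tm_steps K c pre p n x y d :
  prologue_free pre -> maxreg c < K -> steps (cnext p) n x y -> home K c x d ->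
  exists m d', [/\ n <= m, steps (step (pre ++ table K c) p) m d d' & home K c y
    d'].
Proof.
move=> pre0 cK; elim: n y => [|n IH] y.
  by move=> [<-] H; exists 0, d.
rewrite /steps iterS; case E: (iter n _ _) => [z|//] /= zy H.
have [m [d' [nm S H']]] := IH _ E H.
have [m' [d'' [S' H'']]] := tm_cnext pre0 cK zy H'.
exists (m + m'.+1), d''; split => //; last exact: steps_trans S S'.
lia.
Qed.

(* The transitions of a prologue that moves the pebble of register 1 to cell
   [x.+1], where [a], [b] are the codes of the symbols of the cells [0], [x.+1]
   and [q] is the code of the next state. *)
Definition prologue (a b q x : nat) : seq (seq nat) :=
  [seq [:: j.*2; 0; 0; j.*2.+2; if j == 0 then a else 0; 0; 2; 0] |
    j <- iota 0 x.+1]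
  ++ [:: [:: x.+1.*2; 0; 0; q; b; 2; 0; 0]].

Definition machine_of_codes (l : seq (seq nat)) : machine :=
  map transition_of_seq l.

Lemma machine_of_codes_cat l l' :
  machine_of_codes (l ++ l') = machine_of_codes l ++ machine_of_codes l'.
Proof. exact: map_cat. Qed.

Lemma machine_of_codes_surj M : exists l, machine_of_codes l = M.
Proof.
have [i <-] := machine_of_nat_surj M.
by exists (map CodeSeq.decode (CodeSeq.decode i));
  rewrite /machine_of_codes -map_comp.
Qed.

Lemma prologueP a b q x t : t \in machine_of_codes (prologue a b q x) ->
  (exists2 j, j <= x & t = Transition j.*2 None 0 j.*2.+2
    (if j == 0 then a else 0)
     Stay Right None) \/
  t = Transition x.+1.*2 None 0 q b Right Stay None.
Proof.
rewrite /prologue machine_of_codes_cat mem_cat => /orP[|].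
  rewrite /machine_of_codes -map_comp => /mapP[j];
    rewrite mem_iota /= add0n ltnS => jx ->.
  by left; exists j.
by rewrite inE => /eqP->; right.
Qed.

Lemma prologue_freeP a b q x : prologue_free (machine_of_codes
  (prologue a b q x)).
Proof.
by apply/allP => t /prologueP[[j _ ->]|->]; rewrite /= ?negbK ?odd_double.
Qed.

Lemma prologue_step a b q x K c p d t :
  t \in machine_of_codes (prologue a b q x) -> applicable p d t ->
  step (machine_of_codes (prologue a b q x) ++ table K c) p d = Some
    (apply t d).
Proof.
move=> tM td; rewrite /step (@ohead_filter _ _ _ t) ?mem_cat ?tM //.
have [E _ _] := and3P td.
move=> t' /[swap] /and3P[E' _ _]; rewrite -(eqP E) in E'.
rewrite mem_cat => /orP[/prologueP t'M|/tableP[q' [y [_]]]]; last first.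
  rewrite /table_entry; case: delta => //= u [] t'E; rewrite -t'E /= in E'.
  have := congr1 odd (eqP E') => /=; rewrite odd_double /=.
  by case: (prologueP tM) => [[j _ ->]|->] /=; rewrite odd_double.
case: (prologueP tM) t'M E' => [[j jx ->]|->] [[j' j'x ->]|->] //= /eqP.
- by move=> /double_inj->.
- by move=> /(@double_inj x.+1) E'; rewrite -E' ltnn in jx.
- by move=> /(@double_inj _ x.+1) E'; rewrite E' ltnn in j'x.
Qed.

(** Register 1 gets [x.+1] rather than [x], so that it never shares a cell with the other registers,
    which are all 0: the same two symbols then serve for every [x]. *)
Lemma prologue_run K c a b q x p :
  a = symbol_code (~: [set inord 1] : symbol K)%SET ->
  b = symbol_code ([set inord 1] : symbol K)%SET ->
  q = state_code K c ([:: c], Ret) -> 1 < K ->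
  exists d, run (machine_of_codes (prologue a b q x) ++ table K c) p x.+2 = Some
    d /\
    represents c ([:: c], Ret) x.+1 (tape_of K (upd (fun=> 0) 1 x.+1)) 0 [::] d.
Proof.
move=> aE bE qE K1; set M := _ ++ _.
have P j : j <= x.+1 -> exists d, run M p j = Some d /\
    [/\ state d = j.*2, whead d = j, ihead d = 0, output d = [::] &
      forall i, nth 0 (wtape d) i = if (i == 0) && (j != 0) then a else 0].
  elim: j => [|j IH] jx.
    by exists init; split=> //; split=> //= i; rewrite nth_nil andbF.
  have [d [E [Es Eh Ei Eo Et]]] := IH (ltnW jx).
  pose t := transition_of_seq [:: j.*2; 0; 0; j.*2.+2; if j == 0 then a else 0;
    0; 2; 0].
  exists (apply t d); split.
    rewrite /run iterS -/(run M p j) E /=; apply: prologue_step.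
      apply: map_f; rewrite mem_cat; apply/orP; left; apply/mapP.
      by exists j; rewrite ?mem_iota //= add0n.
    by rewrite /applicable /= Es Ei Eh Et /= eqxx; case: j {t E Es Eh Et IH jx}.
  split => //=; rewrite ?Eh ?Ei ?Eo //.
  move=> i; rewrite nth_set_nth /= Et; case: (eqVneq i j) => [->|ij].
    by rewrite andbT; case: ifP.
  by rewrite andbT; case: j ij {t E Es Eh Et IH jx} => [|j] ij;
    rewrite ?(negbTE ij) ?andbT.
have [d [E [Es Eh Ei Eo Et]]] := P x.+1 (leqnn _).
pose t := transition_of_seq [:: x.+1.*2; 0; 0; q; b; 2; 0; 0].
exists (apply t d); split.
  rewrite /run iterS -/(run M p x.+1) E /=; apply: prologue_step.
    by apply: map_f; rewrite mem_cat mem_head orbT.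
  by rewrite /applicable /= Es Ei Eh Et /= eqxx.
split => //=; rewrite ?Eh ?Ei ?Eo //.
have in1 (y : 'I_K.+1) : (y == inord 1) = (y == 1 :> nat).
  by rewrite -val_eqE /= inordK // ltnW.
move=> i; rewrite nth_set_nth /= Et andbT; case: (eqVneq i x.+1) => [->|ix].
  rewrite bE; congr symbol_code; apply/setP => y;
    rewrite finset.in_set1 in1 inE /upd.
  by case: ifP => _; rewrite ?eqxx.
case: (eqVneq i 0) => [->|i0].
  rewrite aE; congr symbol_code; apply/setP => y;
    rewrite finset.in_setC finset.in_set1 in1 inE /upd.
  by case: ifP => _; rewrite ?eqxx.
rewrite (_ : tape_of _ _ _ = finset.set0) /symbol_code ?eqxx //.
apply/setP => y; rewrite finset.in_set0 inE /upd; apply/negbTE.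
by case: ifP => _; rewrite eq_sym.
Qed.

(** The order of the quantifiers is the point: [a], [b], [q] and [T] do not depend on [x], so the
    table is computable from [x]. The bound [n <= m] transfers divergence, the last clause transfers
    halting. *)
Theorem machine_of_cmd c : exists a b q T, forall p x n y,
  let M := machine_of_codes (prologue a b q x ++ T) in
  steps (cnext p) n (Conf [:: c] (upd (fun=> 0) 1 x.+1) 0 [::]) y ->
  exists m d, [/\ n <= m, run M p m = Some d, output d = emitted y &
    stack y = [::] -> step M p d = None].
Proof.
(* The marker [K] has to differ from all registers of [c] and from register 1, which holds the
   parameter. *)
pose K := maxn 1 (maxreg c) + 1.
have [T TE] := machine_of_codes_surj (table K c).
exists (symbol_code (~: [set inord 1] : symbol K)%SET),
  (symbol_code ([set inord 1] : symbol K)%SET), (state_code K c ([:: c], Ret)),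
    T.
move=> p x n y M; rewrite {}/M machine_of_codes_cat TE => S.
have K1 : 1 < K by rewrite /K; lia.
have cK : maxreg c < K by rewrite /K; lia.
have [d [E R]] := @prologue_run K c _ _ _ x p erefl erefl erefl K1.
set M := _ ++ _ in E *.
have pre0 := prologue_freeP (symbol_code (~: [set inord 1] : symbol K)%SET)
  (symbol_code ([set inord 1] : symbol K)%SET) (state_code K c ([:: c], Ret)) x.
have cS : [:: c] \in [::] :: stacks c [::] by rewrite inE stacks_head orbT.
have sK : upd (fun=> 0) 1 x.+1 K = 0 by rewrite /upd ifF //; apply/eqP; lia.
have [m [d' [E' H]]] := tm_return p pre0 cS sK R.
have [m' [d'' [nm' E'' [_ _ [E1 E2 E3 E4 E5]]]]] := tm_steps pre0 cK S H.
have E0 := steps_trans (steps_trans E E') E''.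
exists (x.+2 + m + m'), d''; split => //; first lia.
by move=> y0; rewrite y0 in E1; apply: tm_halt pre0 (Represents E1 E2 E3 E4 E5).
Qed.

(** * Functions computed by while programs *)

Definition runs_to (c : cmd) (s s' : store) : Prop := forall p k i o,
  exists n, steps (cnext p) n (Conf (c :: k) s i o) (Conf k s' i o).

Lemma runs_Skip s : runs_to Skip s s.
Proof. by move=> p k i o; exists 1. Qed.

Lemma runs_Inc r s : runs_to (Inc r) s (upd s r (s r).+1).
Proof. by move=> p k i o; exists 1. Qed.

Lemma runs_Dec r s : runs_to (Dec r) s (upd s r (s r).-1).
Proof. by move=> p k i o; exists 1. Qed.

Lemma runs_Seq c d s s' s'' : runs_to c s s' -> runs_to d s' s'' ->
  runs_to (Seq c d) s s''.
Proof.
move=> H H' p k i o; have [n E] := H p (d :: k) i o; have [m E'] := H' p k i o.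
by exists (n + m).+1; apply: steps1; first reflexivity; apply: steps_trans E E'.
Qed.

Lemma runs_If r c d s s' : runs_to (if s r == 0 then d else c) s s' ->
  runs_to (If r c d) s s'.
Proof.
move=> H p k i o; have [n E] := H p k i o.
by exists n.+1; apply: steps1; first reflexivity.
Qed.

Lemma runs_While0 r c s : s r = 0 -> runs_to (While r c) s s.
Proof. by move=> r0 p k i o; exists 1; rewrite /steps /= /cnext /= r0. Qed.

Lemma runs_While1 r c s s' s'' : s r != 0 -> runs_to c s s' ->
  runs_to (While r c) s' s'' -> runs_to (While r c) s s''.
Proof.
move=> r0 H H' p k i o; have [n E] := H p (While r c :: k) i o.
have [m E'] := H' p k i o; exists (n + m).+1; apply: steps1 (steps_trans E E').
by rewrite /cnext /= (negbTE r0).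
Qed.

Lemma runs_While r c (st : nat -> store) m : (forall j, st j r = j) ->
  (forall j, j < m -> runs_to c (st j.+1) (st j)) ->
    runs_to (While r c) (st m) (st 0).
Proof.
move=> str; elim: m => [|m IH] H; first exact: runs_While0.
apply: (@runs_While1 _ _ _ (st m)); rewrite ?str //; first exact: H.
by apply: IH => j jm; apply: H; exact: leqW.
Qed.

(* Registers above the window [l] are zero: they are the temporaries of the
   programs, which can thus be run inside one another at a shifted base [n]. *)
Definition win (s : store) (n : nat) (l : seq nat) : store :=
  fun x => if x < n then s x else nth 0 l (x - n).

Lemma win_at s n l k : win s n l (k + n) = nth 0 l k.
Proof. by rewrite /win ifN ?addnK // -leqNgt leq_addl. Qed.

Lemma upd_win s n l k v : upd (win s n l) (k + n) v = win s n (set_nth 0 l k v).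
Proof.
apply: funext => x; rewrite /upd /win nth_set_nth /=; case: ltnP => xn.
  by rewrite ifF //; apply/eqP; lia.
by congr (if _ then _ else _); apply/eqP/eqP; lia.
Qed.

Lemma win_ext s n l l' : nth 0 l =1 nth 0 l' -> win s n l = win s n l'.
Proof. by move=> E; apply: funext => x; rewrite /win E. Qed.

Lemma win_cat s n l l' : win s n (l ++ l') = win (win s n l) (size l + n) l'.
Proof.
apply: funext => x; rewrite /win nth_cat; case: ltnP => xn.
  by rewrite ifT //; lia.
rewrite (_ : (x < size l + n) = (x - n < size l)); last by apply/idP/idP; lia.
by case: ifP => // H; congr nth; lia.
Qed.

Lemma runs_win_ext c s n l l1 l2 : runs_to c (win s n l) (win s n l1) ->
  nth 0 l1 =1 nth 0 l2 -> runs_to c (win s n l) (win s n l2).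
Proof. by move=> H /win_ext <-. Qed.

Lemma runs_Inc_win s n l k :
  runs_to (Inc (k + n)) (win s n l) (win s n (set_nth 0 l k (nth 0 l k).+1)).
Proof. by rewrite -upd_win -(win_at s n); exact: runs_Inc. Qed.

Lemma runs_Dec_win s n l k :
  runs_to (Dec (k + n)) (win s n l) (win s n (set_nth 0 l k (nth 0 l k).-1)).
Proof. by rewrite -upd_win -(win_at s n); exact: runs_Dec. Qed.

Lemma runs_If_win k c d s n l s' : runs_to (if nth 0 l k == 0 then d else c)
  (win s n l) s' ->
  runs_to (If (k + n) c d) (win s n l) s'.
Proof. by move=> H; apply: runs_If; rewrite win_at. Qed.

Lemma runs_While_win k c s n (f : nat -> seq nat) m :
  (forall j, nth 0 (f j) k = j) ->
  (forall j, j < m -> runs_to c (win s n (f j.+1)) (win s n (f j))) ->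
  runs_to (While (k + n) c) (win s n (f m)) (win s n (f 0)).
Proof.
by move=> fk H; apply: (@runs_While _ _ (fun j => win s n (f j))) => // j;
  rewrite win_at.
Qed.

(** * Arithmetic and pairing on registers *)

Definition move_reg a b := While a (Seq (Dec a) (Inc b)).

Lemma runs_move_win s n l a b : a != b ->
  runs_to (move_reg (a + n) (b + n)) (win s n l)
    (win s n (set_nth 0 (set_nth 0 l b (nth 0 l b + nth 0 l a)) a 0)).
Proof.
move=> ab; pose f j := set_nth 0 (set_nth 0 l b (nth 0 l b + nth 0 l a - j)) a
  j.
rewrite (@win_ext _ _ l (f (nth 0 l a))) => [|x]; last first.
  by rewrite !nth_set_nth /= addnK; case: eqP => [->|_] //;
    rewrite nth_set_nth /=; case: eqP => [->|].
rewrite -[nth 0 l b + nth 0 l a]subn0 -/(f 0); apply: runs_While_win =>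
  [j|j ja].
  by rewrite /f nth_set_nth /= eqxx.
apply: runs_Seq; first exact: runs_Dec_win.
apply: runs_win_ext; first exact: runs_Inc_win.
move=> x; rewrite /f; do 6 rewrite ?nth_set_nth ?eqxx /=;
  rewrite ?[b == a]eq_sym ?(negbTE ab).
case: (x =P b) => [->|xb]; last by case: (x =P a).
by rewrite [b == a]eq_sym (negbTE ab) /= subnSK //; lia.
Qed.

Ltac win_eq := do 8 try (case=> [|] //=); rewrite ?nth_nil //.

Ltac run_inc := first [ exact: runs_Inc_win | exact: runs_Dec_win |
  exact: runs_Skip
  | exact: runs_move_win ].

Definition double_reg a t :=
  Seq (While a (Seq (Dec a) (Seq (Inc t) (Inc t)))) (move_reg t a).

Lemma runs_double s n a b :
  runs_to (double_reg (1 + n) (2 + n)) (win s n [:: a; b])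
    (win s n [:: a; b.*2]).
Proof.
pose f j := [:: a; j; (b - j).*2]; apply: runs_Seq.
  rewrite (@win_ext _ _ _ (f b)); last by rewrite /f subnn; win_eq.
  apply: runs_While_win => // j jb.
  apply: runs_Seq; first run_inc.
  apply: runs_Seq; first run_inc.
  apply: runs_win_ext; first run_inc.
  by win_eq; rewrite -(subnSK jb) doubleS.
by apply: runs_win_ext; [run_inc | rewrite /f subn0; win_eq].
Qed.

(** This is the cons step of [CodeSeq.code]. Pairs and lists thus share one code: head and tail of a
    nonempty list are the components of a pair, and 0, the code of the empty list, is the only
    number that is not a pair. *)
Definition cpair a b := 2 ^ a * b.*2.+1.

Definition combine n :=
  Seq (double_reg (1 + n) (2 + n)) (Seq (Inc (1 + n))
    (Seq (While (0 + n) (Seq (Dec (0 + n)) (double_reg (1 + n) (2 + n))))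
      (move_reg (1 + n) (0 + n)))).

Lemma runs_combine s n a b :
  runs_to (combine n) (win s n [:: a; b]) (win s n [:: cpair a b]).
Proof.
apply: runs_Seq; first exact: runs_double.
apply: runs_Seq; first run_inc.
rewrite /=; apply: runs_Seq.
  pose f j := [:: j; 2 ^ (a - j) * b.*2.+1].
  rewrite (@win_ext _ _ _ (f a)); last by rewrite /f subnn mul1n; win_eq.
  apply: runs_While_win => // j ja.
  apply: runs_Seq; first run_inc.
  apply: runs_win_ext; first exact: runs_double.
  by win_eq; rewrite -mul2n mulnA -expnS subnSK.
by apply: runs_win_ext; [run_inc | rewrite subn0; win_eq].
Qed.

(* The window [z; a; h; f; g] holds the number to split, the first component,
   half of the number, its parity, and a flag for the continuation. *)
Definition halve n := While (0 + n)
  (Seq (Dec (0 + n)) (If (0 + n) (Seq (Dec (0 + n)) (Inc (2 + n)))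
    (Inc (3 + n)))).

Definition unpair n :=
  If (0 + n) (Seq (Inc (4 + n)) (While (4 + n) (Seq (halve n)
    (Seq (If (3 + n) (Seq (Dec (3 + n)) (Dec (4 + n))) (Inc (1 + n)))
      (move_reg (2 + n) (0 + n)))))) Skip.

Lemma runs_halve s n z a h :
  runs_to (halve n) (win s n [:: z; a; h; 0; 1]) (win s n
    [:: 0; a; h + z./2; odd z : nat; 1]).
Proof.
elim/ltn_ind: z h => -[|[|z]] IH h.
- by rewrite addn0; apply: runs_While0; rewrite (win_at s n _ 0).
- apply: (@runs_While1 _ _ _ (win s n [:: 0; a; h; 1; 1])).
  + by rewrite (win_at s n _ 0).
  + apply: runs_Seq; first run_inc.
    by apply: runs_If_win; rewrite /=; run_inc.
  + by rewrite addn0; apply: runs_While0; rewrite (win_at s n _ 0).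
- apply: (@runs_While1 _ _ _ (win s n [:: z; a; h.+1; 0; 1])).
  + by rewrite (win_at s n _ 0).
  + apply: runs_Seq; first run_inc.
    by apply: runs_If_win; rewrite /=; apply: runs_Seq; run_inc.
  + by rewrite /= negbK -addSnnS; apply: IH.
Qed.

(** Halving as long as the number is even counts the exponent [a]; the odd number left is [b.*2.+1],
    whose half is [b]. *)
Lemma runs_unpair s n a b :
  runs_to (unpair n) (win s n [:: cpair a b]) (win s n [:: b; a]).
Proof.
apply: runs_If_win; rewrite ifF; last by apply/negbTE;
  rewrite /cpair /= muln_eq0 expn_eq0.
apply: runs_Seq; first run_inc; rewrite /=.
suff loop m : runs_to (While (4 + n) (Seq (halve n)
    (Seq (If (3 + n) (Seq (Dec (3 + n)) (Dec (4 + n))) (Inc (1 + n)))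
      (move_reg (2 + n) (0 + n)))))
    (win s n [:: cpair a b; m; 0; 0; 1]) (win s n [:: b; m + a]) by exact: loop
      0.
elim: a m => [|a IH] m.
- apply: (@runs_While1 _ _ _ (win s n [:: b; m])).
  + by rewrite (win_at s n _ 4).
  + apply: runs_Seq; first exact: runs_halve.
    rewrite /cpair mul1n /= odd_double uphalf_double; apply: runs_Seq.
      by apply: runs_If_win; apply: runs_Seq; run_inc.
    by apply: runs_win_ext; [run_inc | rewrite /=; win_eq].
  + by rewrite addn0; apply: runs_While0; rewrite (win_at s n _ 4).
- apply: (@runs_While1 _ _ _ (win s n [:: cpair a b; m.+1; 0; 0; 1])).
  + by rewrite (win_at s n _ 4).
  + apply: runs_Seq; first exact: runs_halve.
    rewrite /cpair expnS -mulnA mul2n odd_double doubleK; apply: runs_Seq.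
      by apply: runs_If_win; run_inc.
    by apply: runs_win_ext; [run_inc | rewrite /=; win_eq].
  + by rewrite -addSnnS; exact: IH.
Qed.

Lemma runs_unpair0 s n : runs_to (unpair n) (win s n [:: 0]) (win s n [:: 0]).
Proof. by apply: runs_If_win; exact: runs_Skip. Qed.

Definition swap n := Seq (move_reg (0 + n) (4 + n))
  (Seq (move_reg (1 + n) (0 + n)) (move_reg (4 + n) (1 + n))).

Lemma runs_swap s n a b l : nth 0 l 2 = 0 ->
  runs_to (swap n) (win s n [:: a, b & l]) (win s n [:: b, a & l]).
Proof.
move=> l2; apply: runs_Seq; first run_inc.
apply: runs_Seq; first run_inc.
apply: runs_win_ext; first run_inc.
by case=> [|[|[|[|[|x]]]]] //=; rewrite ?nth_set_nth /= ?nth_set_nth /= ?l2.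
Qed.

Definition clear r := While r (Dec r).

Lemma runs_clear s n l k : runs_to (clear (k + n)) (win s n l)
  (win s n (set_nth 0 l k 0)).
Proof.
rewrite (@win_ext _ _ l (set_nth 0 l k (nth 0 l k))) => [|x]; last first.
  by rewrite nth_set_nth /=; case: eqP => [->|].
apply: (@runs_While_win _ _ _ _ (fun j => set_nth 0 l k j)) => [j|j ja].
  by rewrite nth_set_nth /= eqxx.
apply: runs_win_ext; first run_inc.
by move=> x; do 4 rewrite ?nth_set_nth ?eqxx /=; case: (x == k).
Qed.

(** * Encoded types and the computable functions between them *)

Class encoding (T : Type) := enc : T -> nat.

#[global] Instance enc_nat : encoding nat := id.
#[global] Instance enc_bool : encoding bool := nat_of_bool.
#[global] Instance enc_pair T U (eT : encoding T) (eU : encoding U) :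
  encoding (T * U) :=
  fun x => cpair (enc x.1) (enc x.2).
#[global] Instance enc_seq T (eT : encoding T) : encoding (seq T) :=
  fun l => CodeSeq.code (map enc l).
(** As lists with at most one entry, options are eliminated by folds. The codes of [None],
    [Some false] and [Some true] are 0, 1 and 2, as in [letter_of_nat]. *)
#[global] Instance enc_option T (eT : encoding T) : encoding (option T) :=
  fun o => enc (seq_of_opt o).

Definition computes T U (eT : encoding T) (eU : encoding U) (f : T -> U) :
  Prop :=
  exists P : nat -> cmd, forall n s x,
    runs_to (P n) (win s n [:: enc x]) (win s n [:: enc (f x)]).
Arguments computes {T U eT eU} f.

(** Programs see codes only, so one program computes all functions that have the same effect on
    codes. *)
Lemma computes_recode T U V W (eT : encoding T) (eU : encoding U)
  (eV : encoding V)
    (eW : encoding W) (f : T -> U) (g : V -> W) (h : V -> T) :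
  computes f -> (forall x, enc (h x) = enc x) ->
    (forall x, enc (g x) = enc (f (h x))) ->
  computes g.
Proof. by move=> [P H] E1 E2; exists P => n s x; rewrite E2 -E1. Qed.

Lemma computes_id T (eT : encoding T) : computes (fun x : T => x).
Proof. by exists (fun=> Skip) => n s x; exact: runs_Skip. Qed.

Lemma computes_cast T U (eT : encoding T) (eU : encoding U) (f : T -> U) :
  (forall x, enc (f x) = enc x) -> computes f.
Proof. by move=> E; exists (fun=> Skip) => n s x; rewrite E; exact: runs_Skip.
  Qed.

Lemma computes_comp T U V (eT : encoding T) (eU : encoding U) (eV : encoding V)
    (g : U -> V) (f : T -> U) :
  computes g -> computes f -> computes (fun x => g (f x)).
Proof.
by move=> [P HP] [Q HQ]; exists (fun n => Seq (Q n) (P n)) => n s x;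
  apply: runs_Seq.
Qed.

Lemma computes_enc_cst T (eT : encoding T) (v : nat) :
  computes (fun _ : T => v).
Proof.
exists (fun n => Seq (clear (0 + n)) (iter v (Seq (Inc (0 + n))) Skip)) =>
  n s x.
apply: runs_Seq; first exact: runs_clear.
suff H m : runs_to (iter v (Seq (Inc (0 + n))) Skip) (win s n [:: m])
  (win s n [:: v + m]).
  by have := H 0; rewrite addn0.
elim: v m => [|v IH] m; first exact: runs_Skip.
by apply: runs_Seq; [run_inc | rewrite /= addSnnS; exact: IH].
Qed.

Lemma computes_cst T U (eT : encoding T) (eU : encoding U) (v : U) :
  computes (fun _ : T => v).
Proof. exact: computes_recode (computes_enc_cst _ (enc v)) (fun=> erefl)
  (fun=> erefl). Qed.

Lemma computes_succn : computes succn.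
Proof. by exists (fun n => Inc (0 + n)) => n s x; run_inc. Qed.

Lemma computes_predn : computes predn.
Proof. by exists (fun n => Dec (0 + n)) => n s x; run_inc. Qed.

(** Lets a program run one register higher, above a value that is to be kept. *)
Lemma runs_behead c s n a l l' :
  runs_to c (win (win s n [:: a]) (1 + n) l) (win (win s n [:: a]) (1 + n) l')
    ->
  runs_to c (win s n (a :: l)) (win s n (a :: l')).
Proof. by rewrite -(@win_cat s n [:: a] l) -(@win_cat s n [:: a] l'). Qed.

Definition dup n := Seq (While (0 + n) (Seq (Dec (0 + n))
  (Seq (Inc (1 + n)) (Inc (2 + n)))))
  (move_reg (2 + n) (0 + n)).

Lemma runs_dup s n x : runs_to (dup n) (win s n [:: x]) (win s n [:: x; x]).
Proof.
pose f j := [:: j; x - j; x - j]; apply: runs_Seq.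
  rewrite (@win_ext _ _ _ (f x)); last by rewrite /f subnn; win_eq.
  apply: runs_While_win => // j jx.
  apply: runs_Seq; first run_inc.
  apply: runs_Seq; first run_inc.
  apply: runs_win_ext; first run_inc.
  by win_eq; rewrite -(subnSK jx).
by apply: runs_win_ext; [run_inc | rewrite /f subn0; win_eq].
Qed.

Lemma computes_pair T U V (eT : encoding T) (eU : encoding U) (eV : encoding V)
    (f : T -> U) (g : T -> V) :
  computes f -> computes g -> computes (fun x => (f x, g x)).
Proof.
move=> [P HP] [Q HQ]; exists (fun n => Seq (dup n) (Seq (P (1 + n))
  (Seq (swap n)
  (Seq (Q (1 + n)) (combine n))))) => n s x.
apply: runs_Seq; first exact: runs_dup.
apply: runs_Seq; first exact: runs_behead.
apply: runs_Seq; first exact: runs_swap.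
apply: runs_Seq; first exact: runs_behead.
exact: runs_combine.
Qed.

(* The components of [0], which is not a pair, are [0]. *)
Definition ufst (z : nat) : nat := head 0 (CodeSeq.decode z).
Definition usnd (z : nat) : nat := CodeSeq.code (behead (CodeSeq.decode z)).

Lemma ufst_cpair a b : ufst (cpair a b) = a.
Proof. by rewrite /ufst -{1}(CodeSeq.decodeK b) (CodeSeq.codeK (a :: _)). Qed.

Lemma usnd_cpair a b : usnd (cpair a b) = b.
Proof.
by rewrite /usnd -{1}(CodeSeq.decodeK b) (CodeSeq.codeK (a :: _))
  CodeSeq.decodeK.
Qed.

Lemma cpair_usplit z : z = 0 \/ z = cpair (ufst z) (usnd z).
Proof.
case: (CodeSeq.decode z) (CodeSeq.decodeK z) => [|a l] <-; first by left.
by right; rewrite (ufst_cpair a (CodeSeq.code l)) (usnd_cpair a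
  (CodeSeq.code l)).
Qed.

Lemma runs_unpair_u s n z :
  runs_to (unpair n) (win s n [:: z]) (win s n [:: usnd z; ufst z]).
Proof.
case: (cpair_usplit z) => [->|E]; last by rewrite {1}E; exact: runs_unpair.
by apply: runs_win_ext; [exact: runs_unpair0 | win_eq].
Qed.

Lemma computes_ufst : computes ufst.
Proof.
exists (fun n => Seq (unpair n) (Seq (clear (0 + n))
  (move_reg (1 + n) (0 + n)))) => n s x.
apply: runs_Seq; first exact: runs_unpair_u.
apply: runs_Seq; first exact: runs_clear.
by apply: runs_win_ext; [run_inc | win_eq].
Qed.

Lemma computes_usnd : computes usnd.
Proof.
exists (fun n => Seq (unpair n) (clear (1 + n))) => n s x.
apply: runs_Seq; first exact: runs_unpair_u.
by apply: runs_win_ext; [exact: runs_clear | win_eq].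
Qed.

Lemma computes_fst T U (eT : encoding T) (eU : encoding U) :
  computes (@fst T U).
Proof.
apply: (computes_recode (h := fun x => enc x) computes_ufst) => // x.
by rewrite [RHS]ufst_cpair.
Qed.

Lemma computes_snd T U (eT : encoding T) (eU : encoding U) :
  computes (@snd T U).
Proof.
apply: (computes_recode (h := fun x => enc x) computes_usnd) => // x.
by rewrite [RHS]usnd_cpair.
Qed.

Lemma computes_iter0 T (eT : encoding T) (h : T -> T) :
  computes h -> computes (fun x : T * nat => iter x.2 h x.1).
Proof.
move=> [P HP]; exists (fun n => Seq (unpair n)
  (Seq (While (0 + n) (Seq (Dec (0 + n)) (P (1 + n))))
    (move_reg (1 + n) (0 + n)))) => n s [x m].
apply: runs_Seq; first exact: runs_unpair.
apply: runs_Seq.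
  pose f j := [:: j; @enc T eT (iter (m - j) h x)].
  rewrite (@win_ext _ _ _ (f m)); last by rewrite /f subnn; win_eq.
  apply: runs_While_win => // j jm.
  apply: runs_Seq; first run_inc.
  by rewrite /f /= -(subnSK jm) /=; apply: runs_behead.
by apply: runs_win_ext; [run_inc | rewrite subn0; win_eq].
Qed.

(** The code of the remaining list is itself the loop register: it is 0 exactly when the list is
    empty. *)
Lemma computes_foldl0 T U (eT : encoding T) (eU : encoding U) (h : T * U -> T) :
  computes h -> computes (fun x : T * seq U =>
    foldl (fun a y => h (a, y)) x.1 x.2).
Proof.
move=> [P HP]; exists (fun n => Seq (unpair n)
  (Seq (While (0 + n) (Seq (swap n) (Seq (unpair (1 + n)) (Seq (swap n)
    (Seq (combine (1 + n)) (P (1 + n)))))))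
  (move_reg (1 + n) (0 + n)))) => n s [x l].
apply: runs_Seq; first exact: runs_unpair.
apply: (@runs_Seq _ _ _ (win s n [:: 0; enc (foldl (fun a y => h (a, y)) x
  l)])); last first.
  by apply: runs_win_ext; [run_inc | win_eq].
rewrite -[enc (x, l).1]/(enc x) -[enc (x, l).2]/(enc l).
elim: l x => [|y l IH] x; first by apply: runs_While0; rewrite (win_at s n _ 0).
apply: (@runs_While1 _ _ _ (win s n [:: enc l; enc (h (x, y))])) => //.
  by rewrite (win_at s n _ 0) /= muln_eq0 expn_eq0.
apply: runs_Seq; first exact: runs_swap.
apply: (@runs_Seq _ _ _ (win s n [:: enc x; enc l; enc y])).
  by apply: runs_behead; exact: runs_unpair.
apply: runs_Seq; first exact: runs_swap.
apply: (@runs_Seq _ _ _ (win s n [:: enc l; enc (x, y)])).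
  by apply: runs_behead; exact: runs_combine.
exact: runs_behead.
Qed.

Section Combinators.
Context {T U V : Type} {eT : encoding T} {eU : encoding U} {eV : encoding V}.

Lemma computes_ext (f g : T -> U) : f =1 g -> computes f -> computes g.
Proof. by move=> /funext->. Qed.

Lemma computes_fst_of (f : T -> U * V) : computes f ->
  computes (fun x => (f x).1).
Proof. exact: computes_comp (computes_fst _ _). Qed.

Lemma computes_snd_of (f : T -> U * V) : computes f ->
  computes (fun x => (f x).2).
Proof. exact: computes_comp (computes_snd _ _). Qed.

End Combinators.

Section Recursion.
Context {T U V : Type} {eT : encoding T} {eU : encoding U} {eV : encoding V}.

Lemma computes_iter (h : T -> U -> U) (n : T -> nat) (a : T -> U) :
  computes (fun z : T * U => h z.1 z.2) -> computes n -> computes a ->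
  computes (fun x => iter (n x) (h x) (a x)).
Proof.
move=> Hh Hn Ha.
(* [computes_iter0] iterates a function without parameter, so [x] is carried along in a pair. *)
have E x : iter (n x) (h x) (a x) =
    (iter (n x) (fun y => (y.1, h y.1 y.2)) (x, a x)).2.
  suff: iter (n x) (fun y => (y.1, h y.1 y.2)) (x, a x) =
    (x, iter (n x) (h x) (a x)) by move->.
  by elim: (n x) => //= k ->.
apply: computes_ext (fun x => esym (E x)) _; apply: computes_snd_of.
apply: (computes_comp (f := fun x => ((x, a x), n x)) (computes_iter0 _)).
  exact: computes_pair (computes_fst _ _) Hh.
by apply: computes_pair Hn; apply: computes_pair Ha; exact: computes_id.
Qed.

Lemma computes_foldl (h : T -> U -> V -> U) (l : T -> seq V) (a : T -> U) :
  computes (fun z : T * (U * V) => h z.1 z.2.1 z.2.2) -> computes l ->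
    computes a ->
  computes (fun x => foldl (h x) (a x) (l x)).
Proof.
move=> Hh Hl Ha.
pose F (z : T * U * V) := (z.1.1, h z.1.1 z.1.2 z.2).
have E x : foldl (h x) (a x) (l x) = (foldl (fun b y => F (b, y)) (x, a x)
  (l x)).2.
  suff: foldl (fun b y => F (b, y)) (x, a x) (l x) =
    (x, foldl (h x) (a x) (l x)) by move->.
  by elim: (l x) (a x) => //= y k IH b; rewrite IH.
apply: computes_ext (fun x => esym (E x)) _; apply: computes_snd_of.
apply: (computes_comp (f := fun x => ((x, a x), l x)) (computes_foldl0 _));
  last first.
  by apply: computes_pair Hl; apply: computes_pair Ha; exact: computes_id.
have H11 : computes (fun z : T * U * V => z.1.1).
  exact/computes_fst_of/computes_fst.
apply: (computes_pair H11).
apply: (computes_comp (f := fun z : T * U * V => (z.1.1, (z.1.2, z.2))) Hh).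
apply: (computes_pair H11); apply: computes_pair (computes_snd _ _).
exact/computes_snd_of/computes_fst.
Qed.

Lemma computes_nat_of_bool (b : T -> bool) : computes b ->
  computes (fun x => nat_of_bool (b x)).
Proof. exact/computes_comp/computes_cast. Qed.

Lemma computes_if (b : T -> bool) (f g : T -> U) : computes b -> computes f ->
  computes g ->
  computes (fun x => if b x then f x else g x).
Proof.
move=> Hb Hf Hg; apply: (@computes_ext _ _ _ _ (fun x =>
  iter (nat_of_bool (b x)) (fun=> f x) (g x))).
  by move=> x; case: (b x).
apply: computes_iter (computes_nat_of_bool Hb) Hg.
exact: computes_comp Hf (computes_fst _ _).
Qed.

Lemma computes_succ_of (f : T -> nat) : computes f ->
  computes (fun x => (f x).+1).
Proof. exact: computes_comp computes_succn. Qed.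

Lemma computes_pred_of (f : T -> nat) : computes f ->
  computes (fun x => (f x).-1).
Proof. exact: computes_comp computes_predn. Qed.

Lemma computes_cons (a : T -> U) (l : T -> seq U) : computes a -> computes l ->
  computes (fun x => a x :: l x).
Proof.
move=> Ha Hl; apply: (computes_comp (f := fun x => (a x, l x))
  (g := fun z => z.1 :: z.2)).
  exact: computes_cast.
exact: computes_pair.
Qed.

Lemma computes_behead (l : T -> seq U) : computes l ->
  computes (fun x => behead (l x)).
Proof.
apply: computes_comp; apply: (computes_recode (h := fun x => enc x)
  computes_usnd) => // x.
by case: x => [|a k] //; rewrite [RHS]usnd_cpair.
Qed.

Lemma computes_seq_of_opt (o : T -> option U) :
  computes o -> computes (fun x => seq_of_opt (o x)).
Proof. exact/computes_comp/computes_cast. Qed.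

End Recursion.

(* Reduces [computes (fun x => e)] to the same goal for the arguments of the
   head symbol of [e]. *)
Ltac computes_core := cbv beta; match goal with
  | H : computes _ |- _ => exact H
  | H : computes ?f |- computes (fun x => ?f _) => apply: (computes_comp H)
  | |- computes (fun x => x) => exact: computes_id
  | |- computes fst => exact: computes_fst
  | |- computes snd => exact: computes_snd
  | |- computes S => exact: computes_succn
  | |- computes (fun _ => ?c) => exact: computes_cst
  | |- computes (fun x => (_, _)) => apply: computes_pair
  | |- computes (fun x => fst _) => apply: computes_fst_of
  | |- computes (fun x => snd _) => apply: computes_snd_of
  | |- computes (fun x => if _ then _ else _) => apply: computes_if
  | |- computes (fun x => nat_of_bool _) => apply: computes_nat_of_bool
  | |- computes (fun x => S _) => apply: computes_succ_of
  | |- computes (fun x => predn _) => apply: computes_pred_of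
  | |- computes (fun x => cons _ _) => apply: computes_cons
  | |- computes (fun x => behead _) => apply: computes_behead
  | |- computes (fun x => seq_of_opt _) => apply: computes_seq_of_opt
  | |- computes (fun x => iter _ _ _) => apply: computes_iter
  | |- computes (fun x => foldl _ _ _) => apply: computes_foldl
  end.

(** * Arithmetic and Boolean functions *)

Lemma computes_addn T (eT : encoding T) (a b : T -> nat) : computes a ->
  computes b -> computes (fun x => a x + b x).
Proof.
move=> Ha Hb; apply: (@computes_ext _ _ _ _ (fun x => iter (a x) succn (b x))).
  by move=> x; rewrite iter_succn addnC.
by do ![computes_core].
Qed.

Lemma computes_subn T (eT : encoding T) (a b : T -> nat) : computes a ->
  computes b -> computes (fun x => a x - b x).
Proof.
move=> Ha Hb; apply: (@computes_ext _ _ _ _ (fun x => iter (b x) predn (a x))).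
  by move=> x; rewrite iter_predn.
by do ![computes_core].
Qed.

Lemma computes_muln T (eT : encoding T) (a b : T -> nat) : computes a ->
  computes b -> computes (fun x => a x * b x).
Proof.
move=> Ha Hb; apply: (@computes_ext _ _ _ _ (fun x =>
  iter (a x) (addn (b x)) 0)).
  by move=> x; rewrite iter_addn_0 mulnC.
do ![computes_core].
by apply: computes_addn; do ![computes_core].
Qed.

Lemma computes_eq0 T (eT : encoding T) (a : T -> nat) : computes a ->
  computes (fun x => a x == 0).
Proof.
move=> Ha; apply: (@computes_ext _ _ _ _ (fun x =>
  iter (a x) (fun=> false) true)).
  by move=> x; case: (a x).
by do ![computes_core].
Qed.

Lemma computes_leq T (eT : encoding T) (a b : T -> nat) : computes a ->
  computes b -> computes (fun x => a x <= b x).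
Proof. by move=> Ha Hb; apply: computes_eq0; apply: computes_subn. Qed.

Lemma computes_andb T (eT : encoding T) (c d : T -> bool) : computes c ->
  computes d -> computes (fun x => c x && d x).
Proof. by move=> Hc Hd; apply: computes_ext (computes_if Hc Hd
  (computes_cst _ _ false)) => x; case: (c x). Qed.

Lemma computes_orb T (eT : encoding T) (c d : T -> bool) : computes c ->
  computes d -> computes (fun x => c x || d x).
Proof. by move=> Hc Hd; apply: computes_ext (computes_if Hc
  (computes_cst _ _ true) Hd) => x; case: (c x). Qed.

Lemma computes_negb T (eT : encoding T) (c : T -> bool) : computes c ->
  computes (fun x => ~~ c x).
Proof. by move=> Hc; apply: computes_ext (computes_if Hc
  (computes_cst _ _ false) (computes_cst _ _ true)) => x; case: (c x). Qed.

Lemma computes_implyb T (eT : encoding T) (c d : T -> bool) : computes c ->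
  computes d -> computes (fun x => c x ==> d x).
Proof. by move=> Hc Hd; apply: computes_ext (computes_if Hc Hd
  (computes_cst _ _ true)) => x; case: (c x). Qed.

Lemma computes_eqn T (eT : encoding T) (a b : T -> nat) : computes a ->
  computes b -> computes (fun x => a x == b x).
Proof.
move=> Ha Hb; apply: (@computes_ext _ _ _ _ (fun x =>
  (a x <= b x) && (b x <= a x))).
  by move=> x; rewrite eqn_leq.
by apply: computes_andb; apply: computes_leq.
Qed.

Lemma computes_half T (eT : encoding T) (a : T -> nat) : computes a ->
  computes (fun x => (a x)./2).
Proof.
move=> Ha; apply: (@computes_ext _ _ _ _
    (fun x => (iter (a x) (fun y => (y.1 + nat_of_bool y.2, ~~ y.2))
      (0, false)).1)).
  move=> x; rewrite [iter _ _ _](_ : _ = ((a x)./2, odd (a x))) //.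
  by elim: (a x) => //= k ->; rewrite /= addnC uphalf_half.
do ![computes_core]; [apply: computes_addn|apply: computes_negb];
  by do ![computes_core].
Qed.

Lemma computes_odd T (eT : encoding T) (a : T -> nat) : computes a ->
  computes (fun x => odd (a x)).
Proof.
move=> Ha; apply: (@computes_ext _ _ _ _ (fun x => iter (a x) negb false)).
  by move=> x; elim: (a x) => //= k ->.
by do ![computes_core]; apply: computes_negb; do ![computes_core].
Qed.

Lemma computes_double T (eT : encoding T) (a : T -> nat) : computes a ->
  computes (fun x => (a x).*2).
Proof.
move=> Ha; apply: (@computes_ext _ _ _ _ (fun x => a x + a x)).
  by move=> x; rewrite addnn.
exact: computes_addn.
Qed.

Lemma computes_maxn T (eT : encoding T) (a b : T -> nat) : computes a ->
  computes b -> computes (fun x => maxn (a x) (b x)).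
Proof. by move=> Ha Hb; apply: computes_if => //; apply: computes_leq => //;
  do ![computes_core]. Qed.

Ltac computes_arith := first [computes_core | match goal with
  | |- computes (fun x => _ && _) => apply: computes_andb
  | |- computes (fun x => _ || _) => apply: computes_orb
  | |- computes (fun x => ~~ _) => apply: computes_negb
  | |- computes (fun x => _ ==> _) => apply: computes_implyb
  | |- computes (fun x => addn _ _) => apply: computes_addn
  | |- computes (fun x => subn _ _) => apply: computes_subn
  | |- computes (fun x => muln _ _) => apply: computes_muln
  | |- computes (fun x => leq _ _) => apply: computes_leq
  | |- computes (fun x => @eq_op Datatypes_nat__canonical__eqtype_Equality _ _)
    => apply: computes_eqn
  | |- computes (fun x => half _) => apply: computes_half
  | |- computes (fun x => odd _) => apply: computes_odd
  | |- computes (fun x => double _) => apply: computes_double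
  | |- computes (fun x => maxn _ _) => apply: computes_maxn
  end].

(** * Functions on lists and options *)

Lemma computes_rev {T U} {eT : encoding T} {eU : encoding U} (l : T -> seq U) :
  computes l -> computes (fun x => rev (l x)).
Proof.
move=> Hl; apply: (@computes_ext _ _ _ _ (fun x =>
  foldl (fun k y => y :: k) [::] (l x))).
  move=> x; rewrite -[RHS]cats0 -/(catrev _ _) -catrevE.
  by elim: (l x) [::] => //= y k IH m; rewrite IH.
by do ![computes_arith].
Qed.

Lemma computes_cat {T U} {eT : encoding T} {eU : encoding U} (l m : T -> seq U)
  : computes l -> computes m ->
  computes (fun x => l x ++ m x).
Proof.
move=> Hl Hm; apply: (@computes_ext _ _ _ _
    (fun x => foldl (fun k y => y :: k) (m x) (rev (l x)))).
  move=> x; rewrite -[l x in RHS]revK; elim: (rev (l x)) (m x) => //= y k IH n.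
  by rewrite IH rev_cons cat_rcons.
have Hr := computes_rev Hl; by do ![computes_arith].
Qed.

Lemma computes_map {T U V} {eT : encoding T} {eU : encoding U} {eV : encoding V}
  (h : T -> U -> V) (l : T -> seq U) :
  computes (fun z : T * U => h z.1 z.2) -> computes l ->
  computes (fun x => map (h x) (l x)).
Proof.
move=> Hh Hl; apply: (@computes_ext _ _ _ _
    (fun x => foldl (fun k y => h x y :: k) [::] (rev (l x)))).
  move=> x; rewrite foldl_rev; by elim: (l x) => //= y k ->.
have Hr := computes_rev Hl; do ![computes_arith].
by apply: (computes_comp (f := fun x => (x.1, x.2.2)) Hh); do ![computes_arith].
Qed.

Lemma computes_size {T U} {eT : encoding T} {eU : encoding U} (l : T -> seq U) :
  computes l -> computes (fun x => size (l x)).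
Proof.
move=> Hl; apply: (@computes_ext _ _ _ _ (fun x =>
  foldl (fun n y => n.+1) 0 (l x))).
  move=> x; rewrite -[RHS]addn0; elim: (l x) 0 => //= y k IH n.
  by rewrite IH addnS.
by do ![computes_arith].
Qed.

Lemma computes_drop {T U} {eT : encoding T} {eU : encoding U} (n : T -> nat)
  (l : T -> seq U) : computes n -> computes l ->
  computes (fun x => drop (n x) (l x)).
Proof.
move=> Hn Hl; apply: (@computes_ext _ _ _ _ (fun x => iter (n x) behead (l x))).
  move=> x; elim: (n x) => [|k IH]; first by rewrite drop0.
  by rewrite iterS IH -drop1 drop_drop add1n.
by do ![computes_arith].
Qed.

Lemma computes_last {T U} {eT : encoding T} {eU : encoding U} (a : T -> U)
  (l : T -> seq U) : computes a -> computes l ->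
  computes (fun x => last (a x) (l x)).
Proof.
move=> Ha Hl; apply: (@computes_ext _ _ _ _ (fun x =>
  foldl (fun _ y => y) (a x) (l x))).
  by move=> x; elim: (l x) (a x) => //=.
by do ![computes_arith].
Qed.

Lemma computes_head {T U} {eT : encoding T} {eU : encoding U} (a : T -> U)
  (l : T -> seq U) : computes a -> computes l ->
  computes (fun x => head (a x) (l x)).
Proof.
move=> Ha Hl; apply: (@computes_ext _ _ _ _ (fun x => last (a x) (rev (l x)))).
  by move=> x; case: (l x) => //= y k; rewrite rev_cons last_rcons.
apply: computes_last => //; exact: computes_rev.
Qed.

Lemma computes_nth {T U} {eT : encoding T} {eU : encoding U} (a : T -> U)
  (l : T -> seq U) (n : T -> nat) :
  computes a -> computes l -> computes n ->
  computes (fun x => nth (a x) (l x) (n x)).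
Proof.
move=> Ha Hl Hn; apply: (@computes_ext _ _ _ _ (fun x =>
  head (a x) (drop (n x) (l x)))).
  by move=> x; rewrite -nth0 nth_drop addn0.
by apply: computes_head => //; exact: computes_drop.
Qed.

Lemma computes_rcons {T U} {eT : encoding T} {eU : encoding U} (l : T -> seq U)
  (a : T -> U) : computes l -> computes a ->
  computes (fun x => rcons (l x) (a x)).
Proof.
move=> Hl Ha; apply: (@computes_ext _ _ _ _ (fun x => l x ++ [:: a x])).
  by move=> x; rewrite cats1.
by apply: computes_cat; do ![computes_arith].
Qed.

Lemma computes_nseq {T U} {eT : encoding T} {eU : encoding U} (n : T -> nat)
  (a : T -> U) : computes n -> computes a ->
  computes (fun x => nseq (n x) (a x)).
Proof.
move=> Hn Ha; apply: (@computes_ext _ _ _ _ (fun x =>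
  iter (n x) (cons (a x)) [::])).
  by move=> x; elim: (n x) => //= k ->.
by do ![computes_arith]; apply: computes_comp Ha _; do ![computes_arith].
Qed.

Lemma computes_flatten {T U} {eT : encoding T} {eU : encoding U}
  (l : T -> seq (seq U)) : computes l ->
  computes (fun x => flatten (l x)).
Proof.
move=> Hl; apply: (@computes_ext _ _ _ _ (fun x => foldl cat [::] (l x))).
  move=> x; rewrite -[RHS]cat0s; elim: (l x) [::] => [|y k IH] m /=;
    first by rewrite cats0.
  by rewrite IH catA.
do ![computes_arith]; apply: computes_cat; by do ![computes_arith].
Qed.

Lemma computes_has {T U} {eT : encoding T} {eU : encoding U}
  (h : T -> U -> bool) (l : T -> seq U) :
  computes (fun z : T * U => h z.1 z.2) -> computes l ->
  computes (fun x => has (h x) (l x)).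
Proof.
move=> Hh Hl; apply: (@computes_ext _ _ _ _
    (fun x => foldl (fun b y => b || h x y) false (l x))).
  move=> x; rewrite -[RHS]orFb; elim: (l x) false => [|y k IH] b /=;
    first by rewrite orbF.
  by rewrite IH orbA.
do ![computes_arith].
by apply: (computes_comp (f := fun x => (x.1, x.2.2)) Hh); do ![computes_arith].
Qed.

Lemma computes_filter {T U} {eT : encoding T} {eU : encoding U}
  (h : T -> U -> bool) (l : T -> seq U) :
  computes (fun z : T * U => h z.1 z.2) -> computes l ->
  computes (fun x => [seq y <- l x | h x y]).
Proof.
move=> Hh Hl; apply: (@computes_ext _ _ _ _
    (fun x => foldl (fun k y => if h x y then y :: k else k) [::] (rev (l x)))).
  by move=> x; rewrite foldl_rev; elim: (l x) => //= y k ->.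
have Hr := computes_rev Hl; do ![computes_arith].
by apply: (computes_comp (f := fun x => (x.1, x.2.2)) Hh); do ![computes_arith].
Qed.

Lemma computes_all {T U} {eT : encoding T} {eU : encoding U}
  (h : T -> U -> bool) (l : T -> seq U) :
  computes (fun z : T * U => h z.1 z.2) -> computes l ->
  computes (fun x => all (h x) (l x)).
Proof.
move=> Hh Hl; apply: (@computes_ext _ _ _ _ (fun x =>
  ~~ has (fun y => ~~ h x y) (l x))).
  by move=> x; rewrite has_predC negbK.
by apply/computes_negb/computes_has => //; apply: computes_negb.
Qed.

Lemma computes_iota {T U} {eT : encoding T} {eU : encoding U} (m n : T -> nat) :
  computes m -> computes n ->
  computes (fun x => iota (m x) (n x)).
Proof.
move=> Hm Hn; apply: (@computes_ext _ _ _ _ (fun x =>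
    rev (iter (n x) (fun y => (y.1.+1, y.1 :: y.2)) (m x, [::])).2)).
  move=> x; rewrite [iter _ _ _](_ : _ = (m x + n x, rev (iota (m x) (n x))))
    ?revK //.
  elim: (n x) => [|k IH]; first by rewrite addn0.
  by rewrite iterS IH -[in RHS]addn1 iotaD rev_cat addnA addn1.
by apply: computes_rev; do ![computes_arith].
Qed.

Lemma computes_Some {T U} {eT : encoding T} {eU : encoding U} (f : T -> U) :
  computes f -> computes (fun x => Some (f x)).
Proof.
apply: computes_comp.
apply: (computes_recode (h := id) (f := fun x : U => [:: x])) => //.
by do ![computes_arith].
Qed.

Lemma computes_obind {T U V} {eT : encoding T} {eU : encoding U}
  {eV : encoding V} (h : T -> U -> option V) (o : T -> option U) :
  computes (fun z : T * U => h z.1 z.2) -> computes o ->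
  computes (fun x => obind (h x) (o x)).
Proof.
move=> Hh Ho; apply: (@computes_ext _ _ _ _
    (fun x => foldl (fun _ y => h x y) None (seq_of_opt (o x)))).
  by move=> x; case: (o x).
do ![computes_arith].
by apply: (computes_comp (f := fun x => (x.1, x.2.2)) Hh); do ![computes_arith].
Qed.

Lemma computes_oapp {T U V} {eT : encoding T} {eU : encoding U}
  {eV : encoding V} (h : T -> U -> V) (d : T -> V) (o : T -> option U) :
  computes (fun z : T * U => h z.1 z.2) -> computes d -> computes o ->
  computes (fun x => oapp (h x) (d x) (o x)).
Proof.
move=> Hh Hd Ho; apply: (@computes_ext _ _ _ _
    (fun x => foldl (fun _ y => h x y) (d x) (seq_of_opt (o x)))).
  by move=> x; case: (o x).
do ![computes_arith].
by apply: (computes_comp (f := fun x => (x.1, x.2.2)) Hh); do ![computes_arith].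
Qed.

Lemma computes_omap {T U V} {eT : encoding T} {eU : encoding U}
  {eV : encoding V} (h : T -> U -> V) (o : T -> option U) :
  computes (fun z : T * U => h z.1 z.2) -> computes o ->
  computes (fun x => omap (h x) (o x)).
Proof.
by move=> Hh Ho; apply: computes_obind => //; apply: computes_Some.
Qed.

Lemma computes_ohead {T U} {eT : encoding T} {eU : encoding U} (l : T -> seq U)
  : computes l -> computes (fun x => ohead (l x)).
Proof.
move=> Hl; apply: (@computes_ext _ _ _ _
    (fun x => foldl (fun _ y => Some y) None (rev (l x)))).
  by move=> x; rewrite foldl_rev; case: (l x).
have Hr := computes_rev Hl; do ![computes_arith].
by apply: computes_Some; do ![computes_arith].
Qed.

Lemma computes_isSome {T U} {eT : encoding T} {eU : encoding U}
  (o : T -> option U) : computes o -> computes (fun x => isSome (o x)).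
Proof.
move=> Ho; apply: (@computes_ext _ _ _ _ (fun x =>
  oapp (fun=> true) false (o x))).
  by move=> x; case: (o x).
by apply: computes_oapp; do ![computes_arith].
Qed.

Lemma computes_set_nth {T U} {eT : encoding T} {eU : encoding U} (a : T -> U)
  (l : T -> seq U) (n : T -> nat) (b : T -> U) :
  computes a -> computes l -> computes n -> computes b ->
  computes (fun x => set_nth (a x) (l x) (n x) (b x)).
Proof.
move=> Ha Hl Hn Hb; apply: (@computes_ext _ _ _ _ (fun x =>
  [seq if i == n x then b x else nth (a x) (l x) i |
    i <- iota 0 (maxn (n x).+1 (size (l x)))])).
  move=> x; apply/esym; apply: (@eq_from_nth _ (a x)) => [|i].
    by rewrite size_set_nth size_map size_iota.
  rewrite size_set_nth => ix; rewrite (nth_map 0) ?size_iota // nth_iota //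
    add0n.
  by rewrite nth_set_nth.
have Hs := computes_size Hl.
apply: computes_map; last by apply: computes_iota; do ![computes_arith].
have A (C : Type) (eC : encoding C) (f : T -> C) : computes f ->
    computes (fun z : T * nat => f z.1).
  by move=> Hf; apply: computes_comp Hf (computes_fst _ _).
have := A _ _ _ Hb; have := A _ _ _ Hn.
move=> *; do ![computes_arith].
by apply: computes_nth; do ![computes_arith]; apply: A.
Qed.

Ltac computes_tac := do ![first [computes_arith | match goal with
  | |- computes (fun x => rev _) => apply: computes_rev
  | |- computes (fun x => cat _ _) => apply: computes_cat
  | |- computes (fun x => map _ _) => apply: computes_map
  | |- computes (fun x => size _) => apply: computes_size
  | |- computes size => exact: computes_size (computes_id _)
  | |- computes (fun x => drop _ _) => apply: computes_drop
  | |- computes (fun x => last _ _) => apply: computes_last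
  | |- computes (fun x => head _ _) => apply: computes_head
  | |- computes (fun x => nth _ _ _) => apply: computes_nth
  | |- computes (fun x => rcons _ _) => apply: computes_rcons
  | |- computes (fun x => nseq _ _) => apply: computes_nseq
  | |- computes (fun x => flatten _) => apply: computes_flatten
  | |- computes (fun x => has _ _) => apply: computes_has
  | |- computes (fun x => all _ _) => apply: computes_all
  | |- computes (fun x => seq.filter _ _) => apply: computes_filter
  | |- computes (fun x => iota _ _) => apply: computes_iota
  | |- computes (fun x => Some _) => apply: computes_Some
  | |- computes (fun x => obind _ _) => apply: computes_obind
  | |- computes (fun x => omap _ _) => apply: computes_omap
  | |- computes (fun x => oapp _ _ _) => apply: computes_oapp
  | |- computes (fun x => ohead _) => apply: computes_ohead
  | |- computes (fun x => isSome _) => apply: computes_isSome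
  | |- computes (fun x => set_nth _ _ _ _) => apply: computes_set_nth
  end]].

(** * Simulation of Turing machines *)

#[global] Instance enc_move : encoding move :=
  fun d => match d with Stay => 0 | Left => 1 | Right => 2 end.

Definition transition_fields (t : transition) :=
  (t_state t, (t_in t, (t_work t, (t_next t, (t_write t,
    (t_imove t, (t_wmove t, t_emit t))))))).

#[global] Instance enc_transition : encoding transition :=
  fun t => enc (transition_fields t).

Definition config_fields (c : config) :=
  (state c, (ihead c, (whead c, (wtape c, output c)))).

#[global] Instance enc_config : encoding config := fun c =>
  enc (config_fields c).

Lemma computes_transition_fields : computes transition_fields.
Proof. exact: computes_cast. Qed.

Lemma computes_config_fields : computes config_fields.
Proof. exact: computes_cast. Qed.

Lemma computes_Config T (eT : encoding T) (s h w : T -> nat) (t : T -> seq nat)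
    (o : T -> seq bool) :
  computes s -> computes h -> computes w -> computes t -> computes o ->
  computes (fun x => Config (s x) (h x) (w x) (t x) (o x)).
Proof.
move=> Hs Hh Hw Ht Ho.
apply: (@computes_recode _ _ _ _ _ _ _ _ (fun x =>
  (s x, (h x, (w x, (t x, o x))))) _ id) => //.
by computes_tac.
Qed.

Lemma computes_letter_of_nat : computes letter_of_nat.
Proof.
apply: (@computes_recode _ _ _ _ _ _ _ _ (fun n => if n <= 1 then n else 2) _
  id) => //.
  by computes_tac.
by case=> [|[|n]].
Qed.

Lemma computes_move_of_nat : computes move_of_nat.
Proof.
apply: (@computes_recode _ _ _ _ _ _ _ _ (fun n => if n <= 1 then n else 2) _
  id) => //.
  by computes_tac.
by case=> [|[|n]].
Qed.

Lemma computes_transition_of_seq : computes transition_of_seq.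
Proof.
have Hl := computes_letter_of_nat; have Hm := computes_move_of_nat.
apply: (@computes_recode _ _ _ _ _ _ _ _
  (fun s => transition_fields (transition_of_seq s)) _ id) => //.
by rewrite /transition_of_seq /transition_fields /=; computes_tac.
Qed.

Lemma computes_decode : computes CodeSeq.decode.
Proof. by apply: computes_cast => n; rewrite /enc /enc_seq map_id
  CodeSeq.decodeK. Qed.

Lemma computes_machine_of_nat : computes machine_of_nat.
Proof.
have Ht := computes_transition_of_seq; have Hd := computes_decode.
by rewrite /machine_of_nat; computes_tac.
Qed.

(** Machines are run on [padded V] for [size V] steps only; they cannot read beyond [V] in this
    time, so the zeros do not influence the result. *)
Definition padded (V : seq nat) : baire := fun i => nth 0 V i.

Lemma computes_unary_padded : computes (fun z : seq nat * nat =>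
  unary (padded z.1) z.2).
Proof. by rewrite /unary /padded; computes_tac. Qed.

Lemma computes_input_cell_padded :
  computes (fun z : seq nat * nat => input_cell (padded z.1) z.2).
Proof.
have H := computes_unary_padded.
apply: (@computes_ext _ _ _ _ (fun z : seq nat * nat =>
    if z.2 == 0 then None else Some (unary (padded z.1) z.2.-1))).
  by move=> [V [|n]].
computes_tac.
by apply: (computes_comp (f := fun z : seq nat * nat => (z.1, z.2.-1)) H);
  computes_tac.
Qed.

Lemma computes_eq_letter T (eT : encoding T) (a b : T -> option bool) :
  computes a -> computes b -> computes (fun x => a x == b x).
Proof.
move=> Ha Hb; apply: (@computes_ext _ _ _ _ (fun x => enc (a x) == enc (b x))).
  by move=> x; case: (a x) (b x) => [[]|] [[]|].
have E : computes (fun o : option bool => enc o) by exact: computes_cast.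
by apply: computes_eqn; [exact: (computes_comp E Ha) |
  exact: (computes_comp E Hb)].
Qed.

Lemma computes_shift T (eT : encoding T) (d : T -> move) (n : T -> nat) :
  computes d -> computes n -> computes (fun x => shift (d x) (n x)).
Proof.
move=> Hd Hn; apply: (@computes_ext _ _ _ _ (fun x =>
    if enc (d x) == 0 then n x else if enc (d x) == 1 then (n x).-1 else
      (n x).+1)).
  by move=> x; case: (d x).
have E : computes (fun o : move => enc o) by exact: computes_cast.
have {}E := computes_comp E Hd.
by computes_tac.
Qed.

Lemma computes_applicable : computes (fun z : seq nat * config * transition =>
  applicable (padded z.1.1) z.1.2 z.2).
Proof.
have Ht := computes_transition_fields; have Hc := computes_config_fields.
have Hi := computes_input_cell_padded.
pose t (z : seq nat * config * transition) := transition_fields z.2.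
pose c (z : seq nat * config * transition) := config_fields z.1.2.
have Hcz : computes c by rewrite /c; computes_tac.
have Htz : computes t by rewrite /t; computes_tac.
apply: (@computes_ext _ _ _ _ (fun z => [&& (t z).1 == (c z).1,
  (t z).2.1 == input_cell (padded z.1.1) (c z).2.1
  & (t z).2.2.1 == nth 0 (c z).2.2.2.1 (c z).2.2.1])) => //.
computes_tac.
apply: computes_eq_letter; first by computes_tac.
apply: (computes_comp (f := fun z : seq nat * config * transition =>
  (z.1.1, (c z).2.1)) Hi).
by computes_tac.
Qed.

Lemma computes_apply : computes (fun z : config * transition => apply z.2 z.1).
Proof.
have Ht := computes_transition_fields; have Hc := computes_config_fields.
pose t (z : config * transition) := transition_fields z.2.
pose c (z : config * transition) := config_fields z.1.
have Hcz : computes c by rewrite /c; computes_tac.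
have Htz : computes t by rewrite /t; computes_tac.
apply: (@computes_ext _ _ _ _ (fun z => Config (t z).2.2.2.1
  (shift (t z).2.2.2.2.2.1 (c z).2.1) (shift (t z).2.2.2.2.2.2.1 (c z).2.2.1)
  (set_nth 0 (c z).2.2.2.1 (c z).2.2.1 (t z).2.2.2.2.1)
  (oapp (fun b => rcons (c z).2.2.2.2 b) (c z).2.2.2.2 (t z).2.2.2.2.2.2.2))) =>
    //.
by apply: computes_Config; try apply: computes_shift; computes_tac.
Qed.

Lemma computes_step_padded : computes (fun z : machine * seq nat * config =>
  step z.1.1 (padded z.1.2) z.2).
Proof.
have Ha := computes_apply; have Hp := computes_applicable.
rewrite /step; computes_tac.
  apply: (computes_comp (f := fun z : machine * seq nat * config * transition =>
    (z.1.2, z.2)) Ha); by computes_tac.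
apply: (computes_comp (f := fun z : machine * seq nat * config * transition =>
    (z.1.1.2, z.1.2, z.2)) Hp); by computes_tac.
Qed.

Lemma computes_run_padded : computes (fun z : nat * seq nat =>
  run (machine_of_nat z.1) (padded z.2) (size z.2)).
Proof.
have Hs := computes_step_padded; have Hm := computes_machine_of_nat.
rewrite /run; computes_tac.
apply: (computes_comp (f := fun z : nat * seq nat * option config * config =>
    (machine_of_nat z.1.1.1, z.1.1.2, z.2)) Hs); by computes_tac.
Qed.

(** * Programs that read the input letter by letter *)

Definition evals (p : baire) (x y : conf) : Prop := exists n,
  steps (cnext p) n x y.

Lemma evals_refl p x : evals p x x.
Proof. by exists 0. Qed.

Lemma evals_trans p x y z : evals p x y -> evals p y z -> evals p x z.
Proof. by move=> [n H] [m H']; exists (n + m); apply: steps_trans H H'. Qed.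

Lemma evals_Seq p c d k s i o y :
  evals p (Conf (c :: d :: k) s i o) y -> evals p (Conf (Seq c d :: k) s i o) y.
Proof. by apply: evals_trans; exists 1. Qed.

Lemma evals_runs p c k s s' i o y :
  runs_to c s s' -> evals p (Conf k s' i o) y ->
    evals p (Conf (c :: k) s i o) y.
Proof. by move=> H; apply: evals_trans. Qed.

Section Driver.
Context {T : Type} {eT : encoding T}.
Variables (start : nat -> T) (f : T * bool -> T) (emit0 emit1 stop : T -> bool).

Fixpoint driver_state (x : nat) (p : baire) (j : nat) : T :=
  if j is j.+1 then f (driver_state x p j, unary p j) else start x.

Definition driver_letters (u : T) : seq bool :=
  (if emit0 u then [:: false] else [::]) ++ (if emit1 u then [:: true] else
    [::]).

Fixpoint driver_output (x : nat) (p : baire) (j : nat) : seq bool :=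
  if j is j'.+1 then driver_output x p j' ++ driver_letters (driver_state x p j)
  else [::].

Definition when (P : nat -> cmd) (c : cmd) : cmd :=
  Seq (dup 1) (Seq (P 2) (If 2 (Seq (Dec 2) c) Skip)).

(** Register 0 is the flag of the main loop and register 1 holds the state; the letter read and the
    outcomes of tests pass through register 2. *)
Definition driver_store (b : nat) (u : T) : store :=
  win (fun=> 0) 0 [:: b; enc u].

Lemma evals_when p (P : nat -> cmd) g c k b u i o y :
  (forall n s v, runs_to (P n) (win s n [:: enc v]) (win s n [:: enc (g v)])) ->
  evals p (Conf ((if g u then [:: c] else [::]) ++ k) (driver_store b u) i o) y
    ->
  evals p (Conf (when P c :: k) (driver_store b u) i o) y.
Proof.
move=> HP H; apply: evals_Seq.
apply: evals_runs; first by apply: runs_behead; exact: runs_dup.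
apply: evals_Seq.
apply: evals_runs; first by apply: runs_behead; apply: runs_behead; exact: HP.
move: H; case: (g u) => H; last first.
  apply: evals_runs; first by apply: (@runs_If_win 2); exact: runs_Skip.
  by rewrite (@win_ext _ _ _ [:: b; enc u]) //; win_eq.
apply: (evals_trans (y := Conf (Seq (Dec 2) c :: k)
  (win (fun=> 0) 0 [:: b; enc u; 1]) i o)).
  by exists 1.
apply: evals_Seq.
apply: evals_runs; first by apply: (@runs_Dec_win _ 0 _ 2).
by rewrite (@win_ext _ _ _ [:: b; enc u]) //; win_eq.
Qed.

(** One loop serves two purposes: with no output it semi-decides a property of the input, with no
    stop it writes an infinite output. The bound [j <= n] shows that the machine runs for ever if
    [stop] never holds. *)
Theorem driver : computes start -> computes f -> computes emit0 ->
  computes emit1 ->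
  computes stop -> exists2 G : nat -> seq (seq nat), computes G &
  forall x p j, (forall i, i < j -> ~~ stop (driver_state x p i.+1)) ->
  (exists n d, [/\ j <= n, run (machine_of_codes (G x)) p n = Some d &
     output d = driver_output x p j]) /\
  (stop (driver_state x p j.+1) -> halts (machine_of_codes (G x)) p).
Proof.
move=> [Ps Hs] [Pf Hf] [P0 H0] [P1 H1] [Pt Ht].
pose body := Seq (Read 2) (Seq (combine 1) (Seq (Pf 1)
  (Seq (when P0 (Emit false))
  (Seq (when P1 (Emit true)) (when Pt (Dec 0)))))).
pose loop := While 0 body.
(* The initial [Dec 1] undoes the successor in [x.+1], the value that the prologue stores. *)
have [a [b [q [tbl H]]]] :=
  machine_of_cmd (Seq (Dec 1) (Seq (Ps 1) (Seq (Inc 0) loop))).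
exists (fun x => prologue a b q x ++ tbl).
  by rewrite /prologue; computes_tac.
move=> x p j Hstop; set M := machine_of_codes _.
pose L j := Conf [:: loop] (driver_store 1 (driver_state x p j)) j
  (driver_output x p j).
have L0 : evals p (Conf [:: Seq (Dec 1) (Seq (Ps 1) (Seq (Inc 0) loop))]
    (upd (fun=> 0) 1 x.+1) 0 [::]) (L 0).
  have -> : upd (fun=> 0) 1 x.+1 = win (fun=> 0) 0 [:: 0; x.+1].
    by apply: funext => -[|[|[|z]]]; rewrite /upd /win //= nth_nil.
  apply: evals_Seq; apply: evals_runs; first exact: (@runs_Dec_win _ 0 _ 1).
  apply: evals_Seq; apply: evals_runs.
    by apply: runs_behead; exact: (Hs _ _ x).
  apply: evals_Seq; apply: evals_runs; first exact: (@runs_Inc_win _ 0 _ 0).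
  exact: evals_refl.
have LS i : exists n, steps (cnext p) n.+1 (L i)
    (if stop (driver_state x p i.+1)
     then Conf [:: loop] (driver_store 0 (driver_state x p i.+1)) i.+1
       (driver_output x p i.+1)
     else L i.+1).
  suff [n E] : evals p (Conf [:: body; loop] (driver_store 1
    (driver_state x p i)) i
      (driver_output x p i)) (if stop (driver_state x p i.+1)
     then Conf [:: loop] (driver_store 0 (driver_state x p i.+1)) i.+1
       (driver_output x p i.+1)
     else L i.+1).
    by exists n; apply: steps1 E.
  apply: evals_Seq.
  apply: (evals_trans (y := Conf [:: Seq (combine 1)
    (Seq (Pf 1) (Seq (when P0 (Emit false))
    (Seq (when P1 (Emit true)) (when Pt (Dec 0))))); loop] (win (fun=> 0) 0
      [:: 1; enc (driver_state x p i); enc (unary p i)]) i.+1 (driver_output x p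
        i))).
    case E: (unary p i).
      exists 2; rewrite /steps /= /cnext /= E /=.
      by rewrite (@upd_win _ 0 _ 2).
    exists 1; rewrite /steps /= /cnext /= E /=; congr (Some (Conf _ _ _ _)).
    by apply: win_ext; win_eq.
  apply: evals_Seq; apply: evals_runs.
    by apply: runs_behead; exact: runs_combine.
  apply: evals_Seq; apply: evals_runs.
    by apply: runs_behead; exact: (Hf _ _ (driver_state x p i, unary p i)).
  rewrite -/(driver_store 1 (driver_state x p i.+1)).
  set u := driver_state x p i.+1.
  apply: evals_Seq; apply: (evals_when H0).
  apply: (evals_trans (y := Conf [:: Seq (when P1 (Emit true))
    (when Pt (Dec 0)); loop]
    (driver_store 1 u) i.+1 (driver_output x p i ++ if emit0 u then [:: false]
      else [::]))).
    case: (emit0 u); rewrite ?cats0 ?cats1; [by exists 1|exact: evals_refl].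
  apply: evals_Seq; apply: (evals_when H1).
  apply: (evals_trans (y := Conf [:: when Pt (Dec 0); loop]
    (driver_store 1 u) i.+1 (driver_output x p i.+1))).
    rewrite /= /driver_letters -/u catA.
    case: (emit1 u); rewrite ?cats0 ?cats1; [by exists 1|exact: evals_refl].
  apply: (evals_when Ht).
  case: (stop u); last exact: evals_refl.
  by apply: evals_runs (evals_refl _ _); exact: (@runs_Dec_win _ 0 _ 0).
have Lj i : i <= j -> exists2 n, i <= n & steps (cnext p) n
    (Conf [:: Seq (Dec 1) (Seq (Ps 1) (Seq (Inc 0) loop))]
      (upd (fun=> 0) 1 x.+1) 0 [::]) (L i).
  elim: i => [|i IH] ij; first by have [n E] := L0; exists n.
  have [n ni E] := IH (ltnW ij); have [m] := LS i.
  rewrite (negbTE (Hstop i ij)) => E'.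
  by exists (n + m.+1); [lia | apply: steps_trans E E'].
have [n jn E] := Lj j (leqnn j); split.
  have [m [d [nm E' o' _]]] := H p x n _ E.
  by exists m, d; split => //; lia.
move=> st; have [m] := LS j; rewrite st => E'.
have E2 := steps_trans (steps_trans E E')
  (steps1 (erefl : cnext p (Conf [:: loop] (driver_store 0
    (driver_state x p j.+1)) j.+1
     (driver_output x p j.+1)) = Some (Conf [::] _ _ _)) (steps0 _ _)).
have [m' [d [_ E3 _ h]]] := H p x _ _ E2.
by exists m'.+1; rewrite /run iterS -/(run _ p m') E3 /=; exact: h.
Qed.

End Driver.

Lemma machine_of_nat_enc (l : seq (seq nat)) :
  machine_of_nat (enc l) = machine_of_codes l.
Proof.
rewrite /machine_of_nat /enc /enc_seq CodeSeq.codeK -map_comp; apply: eq_map =>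
  s /=.
by rewrite /enc /enc_seq map_id CodeSeq.codeK.
Qed.

(** * Reading a sequence from its unary word *)

Definition word (p : nat -> nat) (m : nat) : seq bool :=
  flatten [seq rcons (nseq (p i) true) false | i <- iota 0 m].

Lemma wordS p m : word p m.+1 = word p m ++ rcons (nseq (p m) true) false.
Proof. by rewrite /word -[m.+1]addn1 iotaD map_cat flatten_cat /= cats0. Qed.

Lemma size_wordS p m : size (word p m.+1) = size (word p m) + (p m).+1.
Proof. by rewrite wordS size_cat size_rcons size_nseq. Qed.

Lemma leq_size_word p m : m <= size (word p m).
Proof. by elim: m => // m IH; rewrite size_wordS; lia. Qed.

Lemma size_word_mono p m n : m <= n -> size (word p m) <= size (word p n).
Proof.
move=> /subnKC <-; elim: (n - m) => [|k IH]; first by rewrite addn0.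
by rewrite addnS size_wordS; lia.
Qed.

Lemma nth_word p m n i : m <= n -> i < size (word p m) ->
  nth false (word p n) i = nth false (word p m) i.
Proof.
move=> /subnKC <- im; elim: (n - m) => [|k IH]; first by rewrite addn0.
rewrite addnS wordS nth_cat ifT //; apply: leq_trans im _.
by apply: size_word_mono; exact: leq_addr.
Qed.

Lemma unary_word p m i : i < size (word p m) ->
  unary p i = nth false (word p m) i.
Proof.
move=> im; rewrite /unary -/(word p i.+1).
have ii : i < size (word p i.+1) := leq_size_word p i.+1.
by case: (leqP m i.+1) => h; [rewrite (nth_word h im) |
  rewrite -(nth_word (ltnW h) ii)].
Qed.

Lemma unary_block p m c : c <= p m -> unary p (size (word p m) + c) = (c < p m).
Proof.
move=> cm; rewrite (@unary_word p m.+1) ?size_wordS; last lia.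
rewrite wordS nth_cat ifN; last lia.
by rewrite addKn nth_rcons size_nseq nth_nseq; case: ltnP => // ?; case: eqP.
Qed.

(* The state of a reader: the number of ones since the last zero, and the values
   read so far. *)
Definition feed (x : nat * seq nat) (b : bool) : nat * seq nat :=
  if b then (x.1.+1, x.2) else (0, rcons x.2 x.1).

Definition reader (p : baire) (j : nat) : nat * seq nat :=
  foldl feed (0, [::]) [seq unary p i | i <- iota 0 j].

Lemma readerS p j : reader p j.+1 = feed (reader p j) (unary p j).
Proof. by rewrite /reader -[j.+1]addn1 iotaD map_cat foldl_cat. Qed.

Lemma readerP p j : exists m c,
  [/\ reader p j = (c, mkseq p m), c <= p m & j = size (word p m) + c].
Proof.
elim: j => [|j [m [c [E cm jE]]]]; first by exists 0, 0.
rewrite readerS E (_ : unary p j = (c < p m)) /feed;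
  last by rewrite jE unary_block.
case: ltnP => h /=.
  by exists m, c.+1; split => //; lia.
exists m.+1, 0; split => //; last by rewrite size_wordS; lia.
rewrite (_ : c = p m); last by lia.
by rewrite /mkseq -[m.+1]addn1 iotaD map_cat cats1.
Qed.

Lemma reader_values p j : (reader p j).2 = mkseq p (size (reader p j).2).
Proof. by have [m [c [-> _ _]]] := readerP p j; rewrite /= size_mkseq. Qed.

Lemma leq_size_reader p j m : size (word p m) <= j -> m <= size (reader p j).2.
Proof.
have [m' [c [-> cm ->]]] := readerP p j; rewrite /= size_mkseq => h.
rewrite leqNgt; apply/negP => /(size_word_mono p); rewrite size_wordS; lia.
Qed.

(** Ensures that a test made after each letter meets every nonempty prefix of [p]. *)
Lemma reader_surj p m : exists2 j, m <= j & (reader p j).2 = mkseq p m.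
Proof.
exists (size (word p m)); first exact: leq_size_word.
rewrite reader_values; congr mkseq; apply/eqP;
  rewrite eqn_leq leq_size_reader // andbT.
have [m' [c [-> cm E]]] := readerP p (size (word p m)); rewrite /= size_mkseq.
rewrite leqNgt; apply/negP => h; have := size_word_mono p h; rewrite size_wordS;
  lia.
Qed.

(** * Machines that search, and machines that write an approximated sequence *)

Lemma run_NoneW M p n m : n <= m -> run M p n = None -> run M p m = None.
Proof.
move=> /subnKC <- E; elim: (m - n) => [|k IH]; first by rewrite addn0.
by rewrite addnS /run iterS -/(run M p (n + k)) IH.
Qed.

Lemma computes_feed : computes (fun z : nat * seq nat * bool => feed z.1 z.2).
Proof. by rewrite /feed; computes_tac. Qed.

(** The s-m-n theorem in the form needed for queries: the program tests [R] on longer and longer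
    prefixes, and only the prologue of its machine depends on [x]. *)
Lemma halting_index (R : nat * seq nat -> bool) : computes R ->
  exists2 g : nat -> nat, computes g &
    forall x p, halts (machine_of_nat (g x)) p <-> exists m,
      R (x, mkseq p m.+1).
Proof.
move=> HR; have Hf := computes_feed.
pose start (x : nat) := (x, (0, [::] : seq nat)).
pose f (z : nat * (nat * seq nat) * bool) := (z.1.1, feed z.1.2 z.2).
(* The test comes after a letter has been read, when the first value may already be complete. The
   empty prefix could be missed in this way, so it is excluded. *)
pose stop (u : nat * (nat * seq nat)) := (0 < size u.2.2) && R (u.1, u.2.2).
have [|||||G HG HD] := @driver _ _ start f (fun=> false) (fun=> false) stop.
- by rewrite /start; computes_tac.
- rewrite /f; computes_tac.
  by apply: (computes_comp (f := fun z : nat * (nat * seq nat) * bool =>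
    (z.1.2, z.2)) Hf); computes_tac.
- exact: computes_cst.
- exact: computes_cst.
- by rewrite /stop; computes_tac.
have St x p j : driver_state start f x p j = (x, reader p j).
  by elim: j => //= j ->; rewrite readerS.
exists (fun x => enc (G x)); first by apply: (computes_comp (g := enc) _ HG);
  exact: computes_cast.
move=> x p; rewrite machine_of_nat_enc; split => [[n halt]|[m Rm]].
  apply: contrapT => noR.
  (* Since [stop] never holds, the machine is still running after [n] steps. *)
  have ns i : ~~ stop (driver_state start f x p i.+1).
    rewrite St /stop /= reader_values; apply/negP => /andP[];
      rewrite size_mkseq.
    by case: (size _) => // m _ Rm; apply: noR; exists m.
  have [[n' [d [nn' E _]]] _] := HD x p n (fun i _ => ns i).
  by rewrite (run_NoneW nn' halt) in E.
have [j mj E] := reader_surj p m.+1.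
have ex : exists j, stop (driver_state start f x p j.+1).
  by exists j.-1; rewrite prednK ?(leq_trans _ mj) // St /stop /= E size_mkseq.
case: (ex_minnP ex) => i si mi.
have [|_ h] := HD x p i; last exact: h.
move=> i' ii'; apply/negP => /mi; lia.
Qed.

Lemma realizer (Phi : seq nat -> seq bool) : computes Phi ->
  exists M, forall p q : baire,
    (forall m k, k < size (Phi (mkseq p m)) ->
      nth false (Phi (mkseq p m)) k = unary q k) ->
    (forall k, exists m0, forall m, m0 <= m -> k < size (Phi (mkseq p m))) ->
    produces M p q.
Proof.
move=> HPhi; have Hf := computes_feed.
(* A state consists of the reader, the number of letters written, and the letter to be written now,
   if any. *)
pose S := (nat * seq nat * (nat * option bool))%type.
pose start (x : nat) : S := ((0, [::] : seq nat), (0, None)).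
pose nxt (y : (nat * seq nat) * nat) : S := (y.1,
  if y.2 < size (Phi y.1.2) then (y.2.+1, Some (nth false (Phi y.1.2) y.2)) else
    (y.2, None)).
pose f (z : S * bool) : S := nxt (feed z.1.1 z.2, z.1.2.1).
pose emit0 (u : S) := oapp negb false u.2.2.
pose emit1 (u : S) := oapp id false u.2.2.
have Hn : computes nxt by rewrite /nxt; computes_tac.
have [|||||G HG HD] := @driver _ _ start f emit0 emit1 (fun=> false).
- exact: computes_cst.
- rewrite /f; apply: (computes_comp Hn); computes_tac.
  by apply: (computes_comp (f := fun z : S * bool => (z.1.1, z.2)) Hf);
    computes_tac.
- by rewrite /emit0; computes_tac.
- by rewrite /emit1; computes_tac.
- exact: computes_cst.
exists (machine_of_codes (G 0)) => p q corr unb.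
pose st := driver_state start f 0 p.
pose e j := (st j).2.1.
have st1 j : (st j).1 = reader p j by elim: j => //= j IH; rewrite readerS -IH.
have eS j : let V := (reader p j.+1).2 in e j.+1 = e j + (e j < size (Phi V)) /\
    driver_letters emit0 emit1 (st j.+1) =
    if e j < size (Phi V) then [:: unary q (e j)] else [::].
  rewrite /= /e /st /= -/st /f /nxt /= /driver_letters /emit0 /emit1 /=.
  rewrite st1 -readerS reader_values; case: ifP => h /=; last by rewrite addn0.
  by rewrite addn1 corr //; case: (unary q _).
have out j : driver_output start f emit0 emit1 0 p j = mkseq (unary q) (e j).
  elim: j => //= j ->; have [-> ->] := eS j.
  case: ifP => _; rewrite ?addn0 ?cats0 // addn1.
  by rewrite /mkseq -[in RHS]addn1 iotaD map_cat.
have e_mono i j : i <= j -> e i <= e j.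
  move=> /subnKC <-; elim: (j - i) => [|k IH]; first by rewrite addn0.
  by rewrite addnS; have [-> _] := eS (i + k); lia.
have e_unb k : exists j, k <= e j.
  elim: k => [|k [j kj]]; first by exists 0.
  have [m0 Hm] := unb k.
  pose j' := maxn j (size (word p m0)).
  have /Hm : m0 <= size (reader p j'.+1).2 by apply: leq_size_reader;
    rewrite /j'; lia.
  rewrite -reader_values => h; exists j'.+1; have [-> _] := eS j'.
  have : k <= e j' by apply: leq_trans kj (e_mono _ _ _); rewrite /j'; lia.
  by rewrite leq_eqVlt => /orP[/eqP<-|]; [rewrite h | ]; lia.
move=> k; have [j kj] := e_unb k.+1.
have [[n [d [_ E o]]] _] := HD 0 p j (fun _ _ => isT).
exists n, d; split => //; rewrite o out (onthE _ k) /mkseq -map_comp.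
by rewrite (nth_map 0) ?size_iota // nth_iota.
Qed.

(** * Finite use of the input *)

Lemma padded_mkseq p m i : i < m -> padded (mkseq p m) i = p i.
Proof. exact: nth_mkseq. Qed.

Lemma eq_word p p' m : (forall i, i < m -> p i = p' i) -> word p m = word p' m.
Proof.
move=> E; rewrite /word; congr flatten; apply/eq_in_map => i;
  rewrite mem_iota => /andP[_ im].
by rewrite E.
Qed.

(** Every value takes up at least one letter, so the first [m] values determine at least [m]
    letters. *)
Lemma eq_unary p p' m i : (forall i, i < m -> p i = p' i) -> i < m ->
  unary p i = unary p' i.
Proof.
move=> E im; have im' p0 := leq_trans im (leq_size_word p0 m).
by rewrite !(@unary_word _ m) // (eq_word E).
Qed.

Lemma step_ihead M p c c' : step M p c = Some c' -> ihead c' <= (ihead c).+1.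
Proof.
rewrite /step; case: (ohead _) => //= t [<-] /=.
by case: (t_imove t) => //=; lia.
Qed.

Lemma run_ihead M p n c : run M p n = Some c -> ihead c <= n.
Proof.
elim: n c => [|n IH] c; first by move=> [<-].
rewrite /run iterS -/(run M p n); case: (run M p n) IH =>
  //= c0 /(_ _ erefl) h /step_ihead.
by move=> /leq_trans; apply; rewrite ltnS.
Qed.

Lemma eq_step M p p' c : (forall i, i < ihead c -> unary p i = unary p' i) ->
  step M p c = step M p' c.
Proof.
move=> E; rewrite /step; congr (omap _ (ohead _)); apply: eq_filter => t.
by rewrite /applicable /input_cell; case: (ihead c) E => // n ->.
Qed.

(** The input head advances by at most one cell per step, so [n] steps depend on fewer than [n]
    letters, or none if [n = 0]. *)
Lemma eq_run M p p' n : (forall i, i < n -> p i = p' i) ->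
  run M p n = run M p' n.
Proof.
elim: n => // n IH E; rewrite /run !iterS -!/(run _ _ n) -IH; last first.
  by move=> i ni; rewrite E // ltnW.
case E0: (run M p n) => [c|//] /=; apply: eq_step => i ic; apply: eq_unary E _.
have := run_ihead E0; lia.
Qed.

Lemma step_output M p c c' : step M p c = Some c' ->
  exists o, output c' = output c ++ o.
Proof.
rewrite /step; case: (ohead _) => //= t [<-] /=.
by case: (t_emit t) => [b|]; [exists [:: b]; rewrite cats1 | exists [::];
  rewrite cats0].
Qed.

Lemma run_output M p n m c c' : n <= m -> run M p n = Some c ->
  run M p m = Some c' ->
  exists o, output c' = output c ++ o.
Proof.
move=> /subnKC <- E; elim: (m - n) c' => [|k IH] c'.
  by rewrite addn0 E => -[->]; exists [::]; rewrite cats0.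
rewrite addnS /run iterS -/(run M p (n + k)); case: (run M p (n + k)) IH =>
  //= d.
move=> /(_ _ erefl) [o E1] /step_output[o' ->]; exists (o ++ o').
by rewrite E1 catA.
Qed.

Definition run_output_of (M : machine) (p : baire) (n : nat) : seq bool :=
  oapp output [::] (run M p n).

Lemma onth_size (T : Type) (s : seq T) x0 k v : onth s k = Some v ->
  k < size s /\ nth x0 s k = v.
Proof.
move=> E; split; last exact: onth_nth E.
by rewrite -onthTE E.
Qed.

Lemma produces_output M p q : produces M p q -> forall n k,
  k < size (run_output_of M p n) -> nth false (run_output_of M p n) k = unary q
    k.
Proof.
move=> H n k; rewrite /run_output_of; case E: (run M p n) => [c|//] /= kc.
have [n' [c' [E' /(onth_size false)[kc' <-]]]] := H k.
case: (leqP n n') => nn.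
  by have [o ->] := run_output nn E E'; rewrite nth_cat kc.
by have [o ->] := run_output (ltnW nn) E' E; rewrite nth_cat kc'.
Qed.

Lemma produces_unbounded M p q : produces M p q -> forall k, exists n0,
  forall n, n0 <= n ->
  k < size (run_output_of M p n).
Proof.
move=> H k; have [n0 [c [E /(onth_size false)[kc _]]]] := H k.
(* [run_output_of] is empty once the machine has halted. This cannot happen: at most one letter is
   written per step, so a halting machine would have a bounded output. *)
have total n : exists d, run M p n = Some d.
  case E1: (run M p n) => [d|]; first by exists d.
  suff B m d : run M p m = Some d -> size (output d) <= n.
    have [m [d [E2 /(onth_size false)[nd _]]]] := H n.
    by have := B _ _ E2; rewrite leqNgt nd.
  have grow i e : run M p i = Some e -> size (output e) <= i.
    elim: i e => [|i IH] e; first by move=> [<-].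
    rewrite /run iterS -/(run M p i); case: (run M p i) IH =>
      //= e0 /(_ _ erefl) h.
    rewrite /step; case: (ohead _) => //= t [<-] /=.
    by case: (t_emit t) => [b|]; rewrite ?size_rcons ?ltnS // leqW.
  move=> E2; case: (leqP n m) => nm; first by rewrite (run_NoneW nm E1) in E2.
  exact: leq_trans (grow _ _ E2) (ltnW nm).
exists n0 => n nn; have [d E1] := total n.
by rewrite /run_output_of E1 /=; have [o ->] := run_output nn E E1;
  rewrite size_cat ltn_addr.
Qed.

(** * Simulation of a machine on a sequence computed from an oracle *)

Definition advance (A : seq nat * seq nat -> option nat) (V L : seq nat) :
  seq nat :=
  oapp (rcons L) L (A (V, L)).

Section Transfer.
Variables (A : seq nat * seq nat -> option nat) (q b : nat -> nat).
Hypothesis sound : forall m n v, A (mkseq q m, mkseq b n) = Some v -> v = b n.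
Hypothesis total : forall n, exists m0, forall m, m0 <= m ->
  A (mkseq q m, mkseq b n).

Lemma mkseqS (f : nat -> nat) n : mkseq f n.+1 = rcons (mkseq f n) (f n).
Proof. by rewrite /mkseq -[n.+1]addn1 iotaD map_cat cats1. Qed.

Lemma iter_advance m k : exists n, iter k (advance A (mkseq q m)) [::] = mkseq b
  n.
Proof.
elim: k => [|k [n E]]; first by exists 0.
rewrite iterS E /advance; case E': (A _) => [v|] /=; last by exists n.
by exists n.+1; rewrite mkseqS (sound E').
Qed.

(** Here [m] is both the length of the oracle prefix and the number of rounds. Once the prefix
    suffices for the first [n] values, each round adds one until [n] are reached. *)
Lemma size_iter_advance n : exists m0, forall m, m0 <= m ->
  n <= size (iter m (advance A (mkseq q m)) [::]).
Proof.
have [m0 H] : exists m0, forall m i, m0 <= m -> i < n ->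
  A (mkseq q m, mkseq b i).
  elim: n => [|n [m0 H]]; first by exists 0.
  have [m1 H1] := total n; exists (maxn m0 m1) => m i; rewrite geq_max.
  by move=> /andP[mm0 mm1]; rewrite ltnS leq_eqVlt => /orP[/eqP->|?];
    [exact: H1 | exact: H].
exists (maxn m0 n) => m; rewrite geq_max => /andP[mm0 nm].
suff S k : minn n k <= size (iter k (advance A (mkseq q m)) [::]).
  by apply: leq_trans (S m); rewrite leq_min leqnn.
elim: k => [|k IH]; first by rewrite minn0.
rewrite iterS; have [i E] := iter_advance m k; rewrite E size_mkseq in IH *.
rewrite /advance; case: (ltnP i n) => h.
  by have := H m i mm0 h; case E': (A _) => [v|//] _ /=;
    rewrite size_rcons size_mkseq; lia.
by case: (A _) => [v|] /=; rewrite ?size_rcons size_mkseq; lia.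
Qed.

End Transfer.

(* [A] computes the next value of [b] from the values of [q] and [b] known so far. *)
Theorem transfer (A : seq nat * seq nat -> option nat) (B : nat -> nat)
  (M : machine) :
  computes A -> computes B -> exists M', forall q b z : baire,
    (forall m n v, A (mkseq q m, mkseq b n) = Some v -> v = b n) ->
    (forall n, exists m0, forall m, m0 <= m -> A (mkseq q m, mkseq b n)) ->
    produces M (fun i => B (b i)) z -> produces M' q z.
Proof.
move=> HA HB; have [i0 <-] := machine_of_nat_surj M.
(* [D V] is the part of the sequence [B (b i)] found from the oracle prefix [V] in [size V] rounds.
   The simulated machine makes only [size (D V)] steps, and so stays within this part. *)
pose D V := map B (iter (size V) (advance A V) [::]).
pose Phi V := oapp output [::] (run (machine_of_nat i0) (padded (D V))
  (size (D V))).
have HD : computes D.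
  by rewrite /D /advance; computes_tac.
have HPhi : computes Phi.
  have Hr := computes_run_padded; have Hc := computes_config_fields.
  apply: (@computes_ext _ _ _ _ (fun V => oapp (fun c =>
    (config_fields c).2.2.2.2) [::]
    (run (machine_of_nat i0) (padded (D V)) (size (D V))))) => //.
  computes_tac.
  by apply: (computes_comp (f := fun V => (i0, D V)) Hr); computes_tac.
have [M' HM'] := realizer HPhi; exists M' => q b z sound total prod.
have DE m : exists n, D (mkseq q m) = mkseq (fun i => B (b i)) n.
  have [n E] := iter_advance sound m m; exists n.
  by rewrite /D size_mkseq E /mkseq -map_comp.
have PhiE m : Phi (mkseq q m) =
    run_output_of (machine_of_nat i0) (fun i => B (b i)) (size (D (mkseq q m))).
  rewrite /Phi /run_output_of; have [n ->] := DE m; rewrite size_mkseq.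
  by congr oapp; apply: eq_run => i im; rewrite padded_mkseq.
apply: HM' => [m k|k].
  by rewrite PhiE; exact: produces_output prod _ _.
have [n0 Hn] := produces_unbounded prod k.
have [m0 Hm] := size_iter_advance sound total n0.
exists m0 => m mm; rewrite PhiE; apply: Hn.
by rewrite /D size_map size_mkseq; exact: Hm.
Qed.

(** * Limits and jumps *)

Lemma limitP (r p : baire) : limit r p <->
  forall k, exists n, forall i, n <= i -> r (npair i k) = p k.
Proof.
rewrite /limit /=; split=> [/pointwise_cvgP H k|H].
  have /discrete_cvg[N _ HN] := H k.
  by exists N => i /HN.
apply/pointwise_cvgP => k; apply/discrete_cvg.
by have [N HN] := H k; exists N => // i /HN.
Qed.

Lemma limit_unique r p p' : limit r p -> limit r p' -> p = p'.
Proof.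
move=> /limitP H /limitP H'; apply: funext => k.
have [n Hn] := H k; have [n' Hn'] := H' k.
by rewrite -(Hn (maxn n n')) ?leq_maxl // Hn' ?leq_maxr.
Qed.

Lemma triangleS s : (s.+1 * s.+2)./2 = (s * s.+1)./2 + s.+1.
Proof.
by rewrite (_ : s.+1 * s.+2 = s * s.+1 + s.+1.*2); [lia | rewrite -mul2n; nia].
Qed.

Lemma leq_triangle s s' : s <= s' -> (s * s.+1)./2 <= (s' * s'.+1)./2.
Proof. by move=> ss; apply: half_leq; apply: leq_mul. Qed.

(** [npair n k] is at least the triangular number of [n + k] and below the next one, which
    determines [n + k]. *)
Lemma npair_inj n k n' k' : npair n k = npair n' k' -> n = n' /\ k = k'.
Proof.
suff sumle a b c d : npair a b = npair c d -> a + b <= c + d.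
  move=> E; have := sumle _ _ _ _ E; have := sumle _ _ _ _ (esym E).
  move=> h1 h2; have s : n + k = n' + k' by lia.
  by move: E; rewrite /npair s => /addnI; lia.
rewrite /npair => E; rewrite leqNgt; apply/negP => h.
have := leq_triangle h; rewrite triangleS; lia.
Qed.

Lemma leq_npair n k : n <= npair n k.
Proof.
rewrite /npair; apply: leq_trans (leq_addr _ _).
suff H s : s <= (s * s.+1)./2 by apply: leq_trans (H _); exact: leq_addr.
by elim: s => // s IH; rewrite triangleS; lia.
Qed.

Lemma limit_surj p : exists r, limit r p.
Proof.
(* All rows are [p]; 0 is a default for numbers that are not of the form [npair n k]. *)
exists (fun m => if pselect (exists nk : nat * nat, npair nk.1 nk.2 = m) is left
  h
  then p (projT1 (cid h)).2 else 0).
apply/limitP => k; exists 0 => i _; case: pselect => [h|[]];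
  last by exists (i, k).
by case: (cid h) => -[n k'] /= /npair_inj[_ ->].
Qed.

(** * Queries to a jump *)

Lemma jumpE p i : (jump p i = 1 /\ halts (machine_of_nat i) p) \/
  (jump p i = 0 /\ ~ halts (machine_of_nat i) p).
Proof. by rewrite /jump; case: asboolP; [left | right]. Qed.

(** A machine stores a number as its parameter, from which [dec] recovers the query. The index [g x]
    does not depend on [p]. *)
Lemma jump_query X (eX : encoding X) (dec : nat -> X) (R : X * seq nat -> bool)
  :
  computes R -> computes dec -> cancel enc dec ->
  exists2 g : X -> nat, computes g & forall p x,
    (jump p (g x) = 1 /\ exists m, R (x, mkseq p m.+1)) \/
    (jump p (g x) = 0 /\ forall m, ~~ R (x, mkseq p m.+1)).
Proof.
move=> HR Hd decK.
have [|g Hg H] := @halting_index (fun z => R (dec z.1, z.2));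
  first by computes_tac.
exists (fun x => g (enc x)); first by apply: (computes_comp Hg);
  exact: computes_cast.
move=> p x; case: (jumpE p (g (enc x))) => -[E /H h]; [left|right]; split => //.
  by case: h => m; rewrite /= decK; exists m.
by move=> m; apply/negP => Rm; apply: h; exists m; rewrite /= decK.
Qed.

(** The queries whether [p i = v] have indices independent of [p], and their answers determine
    [p]. *)
Lemma jump_inj : injective jump.
Proof.
move=> p p' E.
pose R (z : (nat * nat) * seq nat) := (z.1.1 < size z.2) &&
  (nth 0 z.2 z.1.1 == z.1.2).
have Hu := computes_ufst; have Hv := computes_usnd.
have [|||g _ H] := @jump_query _ _ (fun x => (ufst x, usnd x)) R.
- by rewrite /R; computes_tac.
- by computes_tac.
- by move=> [a b]; rewrite [enc _]/(cpair a b) ufst_cpair usnd_cpair.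
have RE f i v m : R (i, v, mkseq f m.+1) <-> i < m.+1 /\ f i = v.
  rewrite -[R _]/((i < size (mkseq f m.+1)) && (nth 0 (mkseq f m.+1) i == v))
    size_mkseq.
  by split=> [/andP[im]|[im <-]]; [rewrite nth_mkseq // => /eqP |
    rewrite im nth_mkseq ?eqxx].
apply: funext => i; case: (H p (i, p i)) => -[p1].
  case: (H p' (i, p i)) => -[]; last by rewrite -E p1.
  by move=> _ [m /RE[_ ->]].
by move=> /(_ i)/negP[]; apply/RE; rewrite ltnSn.
Qed.

(* Whether a machine halts on a finite sequence, within as many steps as it has
   entries: it then does so on every extension of the sequence. *)
Definition halts_on (z : nat * seq nat) : bool :=
  ~~ isSome (run (machine_of_nat z.1) (padded z.2) (size z.2)).

Lemma computes_halts_on : computes halts_on.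
Proof.
by have H := computes_run_padded; rewrite /halts_on; computes_tac.
Qed.

Lemma halts_onP n p m : halts_on (n, mkseq p m) <->
  run (machine_of_nat n) p m = None.
Proof.
rewrite /halts_on /= size_mkseq.
rewrite (@eq_run _ _ p) => [|i im]; last by rewrite padded_mkseq.
by case: (run _ _ _).
Qed.

Lemma computes_npair T (eT : encoding T) (a b : T -> nat) : computes a ->
  computes b ->
  computes (fun x => npair (a x) (b x)).
Proof. by move=> Ha Hb; rewrite /npair; computes_tac. Qed.

(** Replaces unbounded minimization: if something is found, it is the least solution altogether,
    whatever the bound [s]. *)
Definition first_below (P : pred nat) (s : nat) : option nat :=
  ohead [seq c <- iota 0 s | P c].

Lemma first_belowP P s c : first_below P s = Some c -> P c /\ forall c', P c' ->
  c <= c'.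
Proof.
rewrite /first_below; elim: s => [//|s IH].
rewrite -[s.+1]addn1 iotaD filter_cat add0n.
case E: [seq c <- iota 0 s | P c] IH => [|d l] IH /=; last exact: IH.
case Ps: (P s) => //= -[<-]; split=> // c' Pc'; rewrite leqNgt; apply/negP =>
  cs.
have : c' \in [seq c <- iota 0 s | P c] by rewrite mem_filter Pc' mem_iota.
by rewrite E.
Qed.

Lemma first_below_total (P : pred nat) s c : P c -> c < s -> first_below P s.
Proof.
move=> Pc cs; rewrite /first_below.
have : c \in [seq c <- iota 0 s | P c] by rewrite mem_filter Pc mem_iota.
by case: [seq c <- iota 0 s | P c].
Qed.

Lemma computes_first_below T (eT : encoding T) (P : T -> pred nat)
  (s : T -> nat) :
  computes (fun z : T * nat => P z.1 z.2) -> computes s ->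
  computes (fun x => first_below (P x) (s x)).
Proof. by move=> HP Hs; rewrite /first_below; computes_tac. Qed.

(** * The halting problem and the limit, read from the jump *)

Lemma jump_limit_reader : exists2 A : seq nat * seq nat -> option nat,
  computes A &
  forall r p, limit r p ->
    (forall m n v, A (mkseq (jump r) m, mkseq (bpair halting_problem p) n) =
      Some v ->
       v = bpair halting_problem p n) /\
    (forall n, exists m0, forall m, m0 <= m ->
       A (mkseq (jump r) m, mkseq (bpair halting_problem p) n)).
Proof.
have Hu := computes_ufst; have Hv := computes_usnd.
(* Only the length of the prefix is used, as a time bound; the machine itself is run on zeros. *)
pose R0 (z : nat * seq nat) := halts_on (z.1, nseq (size z.2) 0).
have [|||g0 Hg0 H0] := @jump_query _ _ id R0.
- by have Hh := computes_halts_on; rewrite /R0; computes_tac.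
- exact: computes_id.
- by [].
(* For a query [(n, (v, k))]: the prefix shows a row from [n] on whose entry [k] differs from
   [v]. *)
pose R1 (z : (nat * (nat * nat)) * seq nat) := has (fun i => [&& z.1.1 <= i,
  npair i z.1.2.2 < size z.2 & nth 0 z.2 (npair i z.1.2.2) != z.1.2.1]) (iota 0
    (size z.2)).
have [|||g1 Hg1 H1] := @jump_query _ _ (fun x =>
  (ufst x, (ufst (usnd x), usnd (usnd x)))) R1.
- by rewrite /R1; computes_tac; apply: computes_npair; computes_tac.
- by computes_tac.
- move=> [a [b c]]; rewrite [enc _]/(cpair a (cpair b c)).
  by rewrite ufst_cpair usnd_cpair ufst_cpair usnd_cpair.
have g0E r i : jump r (g0 i) = halting_problem i.
  have P m : R0 (i, mkseq r m.+1) <-> run (machine_of_nat i) (fun=> 0) m.+1 =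
    None.
    rewrite /R0 -[size _]/(size (mkseq r m.+1)) size_mkseq
      -(halts_onP i (fun=> 0)).
    suff -> : nseq m.+1 0 = mkseq (fun=> 0) m.+1 by [].
    by apply: (@eq_from_nth _ 0); rewrite ?size_mkseq ?size_nseq // => j jm;
      rewrite nth_mkseq // nth_nseq jm.
  rewrite /halting_problem.
  case: (H0 r i) (jumpE (fun=> 0) i) => -[-> E] [] [->] // h.
    by case: E => m /P E; case: h; exists m.+1.
  by case: h => -[//|n] /P h; move: (E n); rewrite h.
have R1E r m n v k : R1 ((n, (v, k)), mkseq r m) =
    has (fun i => [&& n <= i, npair i k < m & r (npair i k) != v]) (iota 0 m).
  rewrite /R1 -[X in has X _]/(fun i => [&& n <= i, npair i k < size (mkseq r m)
    & nth 0 (mkseq r m) (npair i k) != v]) size_mkseq.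
  apply: eq_has => i; case: (n <= i) => //=; case: ltnP => //= h.
  by rewrite nth_mkseq.
have g1E r n v k : jump r (g1 (n, (v, k))) = 0 <-> forall i, n <= i ->
  r (npair i k) = v.
  case: (H1 r (n, (v, k))) => -[-> E]; split => //.
    case: E => m; rewrite R1E => /hasP[i _ /and3P[ni _ /eqP ne]] H.
    by case: ne; exact: H.
  (* A prefix of length [(npair i k).+1] shows the entry, and the search through this prefix reaches
     row [i] because [i <= npair i k]. *)
  move=> _ i ni; apply/eqP; apply: contraTT (E (npair i k)) => ne;
    rewrite negbK R1E.
  apply/hasP; exists i; last by rewrite ni ltnSn.
  by rewrite mem_iota add0n ltnS leq_npair.
(* [c] codes a guess [(n, v)], namely that entry [k] is [v] in all rows from [n] on. The guess is
   accepted if the answer 0 is visible in [V]. *)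
pose test (V : seq nat) k c := (g1 (ufst c, (usnd c, k)) < size V) &&
  (nth 0 V (g1 (ufst c, (usnd c, k))) == 0).
pose A (z : seq nat * seq nat) := if odd (size z.2)
  then omap usnd (first_below (test z.1 (size z.2)./2) (size z.1))
  else if g0 (size z.2)./2 < size z.1 then Some (nth 0 z.1 (g0 (size z.2)./2))
    else None.
exists A.
  rewrite /A /test; computes_tac; apply: computes_first_below; by computes_tac.
move=> r p lim; set b := bpair _ _.
have AE m n : A (mkseq (jump r) m, mkseq b n) = if odd n
    then omap usnd (first_below (test (mkseq (jump r) m) n./2) m)
    else if g0 n./2 < m then Some (halting_problem n./2) else None.
  rewrite -[LHS]/(if odd (size (mkseq b n))
    then omap usnd (first_below (test (mkseq (jump r) m) (size (mkseq b n))./2)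
      (size (mkseq (jump r) m)))
    else if g0 (size (mkseq b n))./2 < size (mkseq (jump r) m) then
      Some (nth 0 (mkseq (jump r) m) (g0 (size (mkseq b n))./2)) else None).
  rewrite !size_mkseq; case: ifP => // _; case: ifP => // h.
  by rewrite nth_mkseq // g0E.
have testE m k c : test (mkseq (jump r) m) k c <->
    g1 (ufst c, (usnd c, k)) < m /\ forall i, ufst c <= i ->
      r (npair i k) = usnd c.
  rewrite /test size_mkseq -g1E; split=> [/andP[h]|[h h']].
    by rewrite nth_mkseq // => /eqP.
  by rewrite h nth_mkseq // h'.
have /limitP limk := lim.
split=> [m n v|n].
  rewrite AE /b /bpair; case: ifP => _; last by case: ifP => // _ [].
  case E: (first_below _ _) => [c|] //= [<-].
  have [/testE[_ h] _] := first_belowP E.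
  have [n0 h'] := limk n./2.
  by rewrite -(h' (maxn (ufst c) n0)) ?leq_maxr // h ?leq_maxl.
case: (boolP (odd n)) => on; last first.
  by exists (g0 n./2).+1 => m; rewrite AE (negbTE on) => ->.
have [n0 h] := limk n./2.
pose c := cpair n0 (p n./2).
exists (maxn c.+1 (g1 (n0, (p n./2, n./2))).+1) => m; rewrite geq_max =>
  /andP[cm gm].
rewrite AE on; suff : first_below (test (mkseq (jump r) m) n./2) m by case:
  first_below.
by apply: (first_below_total (c := c)) => //; apply/testE;
  rewrite ufst_cpair usnd_cpair.
Qed.

(* [l] lists the values prescribed for the new entries of the columns [k < n]. *)
Definition admissible (z : (nat * (seq nat * seq nat)) * seq nat) : bool :=
  let: (n, (s, l), t) := z in
  [&& size s < size t, all (fun i => nth 0 t i == nth 0 s i) (iota 0 (size s))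
    & all (fun k => all (fun i => (size s <= npair i k) && (npair i k < size t)
      ==>
        (nth 0 t (npair i k) == nth 0 l k)) (iota 0 (size t))) (iota 0 n)].

Lemma computes_admissible : computes admissible.
Proof.
apply: (@computes_ext _ _ _ _ (fun z : (nat * (seq nat * seq nat)) * seq nat =>
  [&& size z.1.2.1 < size z.2,
    all (fun i => nth 0 z.2 i == nth 0 z.1.2.1 i) (iota 0 (size z.1.2.1))
  & all (fun k => all (fun i =>
        (size z.1.2.1 <= npair i k) && (npair i k < size z.2) ==>
        (nth 0 z.2 (npair i k) == nth 0 z.1.2.2 k)) (iota 0 (size z.2))) (iota 0
          z.1.1)])).
  by move=> [[n [s l]] t].
by computes_tac; do ?[apply: computes_npair]; computes_tac.
Qed.

Lemma admissibleP n s l t : admissible (n, (s, l), t) <->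
  [/\ size s < size t, forall i, i < size s -> nth 0 t i = nth 0 s i &
    forall i k, k < n -> size s <= npair i k < size t ->
      nth 0 t (npair i k) = nth 0 l k].
Proof.
split=> [/and3P[st /allP ex /allP col]|[st ex col]].
  split=> // [i si|i k kn /[dup] /andP[_ it] h].
    by apply/eqP/ex; rewrite mem_iota.
  have /allP/(_ i) : all (fun i => (size s <= npair i k) && (npair i k < size t)
    ==>
      (nth 0 t (npair i k) == nth 0 l k)) (iota 0 (size t)) by apply: col;
        rewrite mem_iota.
  rewrite mem_iota (leq_ltn_trans (leq_npair i k) it) => /(_ isT).
  by rewrite h => /eqP.
apply/and3P; split=> //.
  by apply/allP => i; rewrite mem_iota => si; apply/eqP; exact: ex.
apply/allP => k; rewrite mem_iota => kn; apply/allP => i _; apply/implyP => h.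
by apply/eqP; exact: col.
Qed.

(** Even if machine [n] cannot be made to halt, the sequence has to grow in order to become
    infinite. One new entry is enough; [v] is the value prescribed by its column. *)
Lemma admissible_total n s l : exists t, admissible (n, (s, l), t).
Proof.
pose v := if pselect (exists ik : nat * nat, npair ik.1 ik.2 = size s) is left h
  then nth 0 l (projT1 (cid h)).2 else 0.
exists (rcons s v); apply/admissibleP; rewrite size_rcons; split=>
  // [i si|i k kn].
  by rewrite nth_rcons si.
rewrite ltnS -eqn_leq => /eqP E; rewrite -E nth_rcons ltnn eqxx /v.
case: pselect => [h|[]]; last by exists (i, k).
by case: (cid h) => -[i' k'] /=; rewrite E => /npair_inj[_ ->].
Qed.

(* Stage [n] of the construction forces the jump at [n], while the columns
   [k < n] are kept equal to [p k], so that the generic has limit [p]. *)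
Section Forcing.
Variables (g : nat * (seq nat * seq nat) -> nat) (p : baire).
Hypothesis gP : forall x,
  (halting_problem (g x) = 1 /\ exists t, admissible (x, t) && halts_on
    (x.1, t)) \/
  (halting_problem (g x) = 0 /\ forall t, ~~ (admissible (x, t) && halts_on
    (x.1, t))).

(** One search for both answers [a]: after a positive one the extension has to make the machine
    halt, otherwise any admissible extension will do. *)
Definition decides (x : nat * (seq nat * seq nat)) (a c : nat) : bool :=
  admissible (x, CodeSeq.decode c) && ((a == 1) ==>
    halts_on (x.1, CodeSeq.decode c)).

Lemma decides_ex x : exists c, decides x (halting_problem (g x)) c.
Proof.
case: (gP x) => -[-> h].
  by have [t ht] := h; exists (CodeSeq.code t); rewrite /decides CodeSeq.codeK.
case: x h => n [s l] _; have [t ht] := admissible_total n s l.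
by exists (CodeSeq.code t); rewrite /decides CodeSeq.codeK ht.
Qed.

(** Taking the least code makes the choice reproducible by a bounded search. *)
Definition extension x : nat := ex_minn (decides_ex x).

Fixpoint condition (n : nat) : seq nat :=
  if n is n'.+1 then CodeSeq.decode (extension (n', (condition n', mkseq p n')))
  else [::].

Definition stage (n : nat) : nat * (seq nat * seq nat) :=
  (n, (condition n, mkseq p n)).

Lemma stageP n :
  [/\ size (condition n) < size (condition n.+1),
    forall i, i < size (condition n) -> nth 0 (condition n.+1) i = nth 0
      (condition n) i,
    forall i k, k < n -> size (condition n) <= npair i k < size (condition n.+1)
      ->
      nth 0 (condition n.+1) (npair i k) = p k &
    halting_problem (g (stage n)) = 1 -> halts_on (n, condition n.+1)].
Proof.
rewrite /condition -/condition -/(stage n) /extension; case: ex_minnP => c dc _.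
have /andP[/admissibleP[h1 h2 h3] h4] := dc; split=> // [i k kn h|E].
  by rewrite h3 // nth_mkseq.
by rewrite E in h4.
Qed.

Lemma leq_size_condition n : n <= size (condition n).
Proof. by elim: n => // n IH; have [h _ _ _] := stageP n; exact: leq_trans h.
  Qed.

Lemma condition_mono m n : m <= n -> size (condition m) <= size (condition n) /\
  forall i, i < size (condition m) -> nth 0 (condition n) i = nth 0
    (condition m) i.
Proof.
move=> /subnKC <-; elim: (n - m) => [|k [IH1 IH2]]; first by rewrite addn0.
rewrite addnS; have [h1 h2 _ _] := stageP (m + k); split=> [|i im].
  exact: leq_trans IH1 (ltnW h1).
by rewrite h2 ?IH2 //; exact: leq_trans im IH1.
Qed.

Definition generic : baire := fun i => nth 0 (condition i.+1) i.

Lemma genericE n i : i < size (condition n) ->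
  generic i = nth 0 (condition n) i.
Proof.
move=> h; case: (leqP i.+1 n) => hn.
  by have [_ ->] := condition_mono hn; last exact: leq_size_condition.
by have [_ E] := condition_mono (ltnW hn); rewrite /generic E.
Qed.

Lemma generic_column n i k : k < n -> size (condition n) <= npair i k ->
  generic (npair i k) = p k.
Proof.
move=> kn h; have ex : exists m, npair i k < size (condition m).
  by exists (npair i k).+1; exact: leq_size_condition.
(* [m] is the stage that adds the entry. It is not before stage [n], so column [k] is already
   restrained. *)
case: (ex_minnP ex) => -[//|m] hm mmin.
have mk : size (condition m) <= npair i k.
  by rewrite leqNgt; apply/negP => /mmin; rewrite ltnn.
have nm : n <= m.
  rewrite leqNgt; apply/negP => /condition_mono[/(leq_trans hm) h' _].
  by rewrite ltnNge h in h'.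
have [_ _ E _] := stageP m.
by rewrite (genericE hm) E ?mk // (leq_trans kn).
Qed.

Lemma limit_generic : limit generic p.
Proof.
apply/limitP => k; exists (size (condition k.+1)) => i h.
by apply: (@generic_column k.+1) => //; exact: leq_trans h (leq_npair _ _).
Qed.

(** A positive answer is made true by the next condition. A negative one stays true because long
    prefixes of the generic are themselves admissible extensions at stage [n]. *)
Lemma jump_generic n : jump generic n = halting_problem (g (stage n)).
Proof.
have cE m : condition m = mkseq generic (size (condition m)).
  apply: (@eq_from_nth _ 0); rewrite ?size_mkseq // => i im.
  by rewrite nth_mkseq // (genericE im).
have [_ _ _ h1] := stageP n.
case: (gP (stage n)) (jumpE generic n) => -[E h] [] [-> h'] //.
  by case: h'; move: (h1 E); rewrite cE => /halts_onP;
    exists (size (condition n.+1)).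
(* The prefix has to be long enough for the machine to halt within its length, and strictly longer
   than the condition. *)
case: h' => N hN; pose N' := maxn N (size (condition n)).+1.
have /negP[] := h (mkseq generic N'); apply/andP; split; last first.
  by apply/halts_onP; apply: run_NoneW hN; rewrite leq_maxl.
apply/admissibleP; rewrite size_mkseq; split.
- by rewrite leq_max ltnSn orbT.
- move=> i im; rewrite nth_mkseq ?(genericE im) //.
  by rewrite leq_max ltnS (ltnW im) orbT.
- move=> i k kn /andP[h2 h3]; rewrite !nth_mkseq //.
  exact: generic_column h2.
Qed.

End Forcing.

(** * The generic sequence and its jump, computed from the limit and the halting problem *)

Lemma computes_cpair T (eT : encoding T) (a b : T -> nat) : computes a ->
  computes b ->
  computes (fun x => cpair (a x) (b x)).
Proof.
move=> Ha Hb; have E : computes (fun z : nat * nat => enc z) by exact: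
  computes_cast.
exact: (computes_comp E (computes_pair Ha Hb)).
Qed.

(** The jump alone does not carry the construction on, as each stage starts from the current
    condition. So [b n] pairs the jump at [n] with the code of the next condition, and [ufst]
    extracts the jump. *)
Lemma generic_reader : exists2 A : seq nat * seq nat -> option nat, computes A &
  forall p, exists r b, [/\ limit r p, jump r = (fun i => ufst (b i)),
    forall m n v, A (mkseq (bpair halting_problem p) m, mkseq b n) = Some v ->
      v = b n &
    forall n, exists m0, forall m, m0 <= m -> A (mkseq (bpair halting_problem p)
      m, mkseq b n)].
Proof.
have Hu := computes_ufst; have Hv := computes_usnd; have Hd := computes_decode.
have Hh := computes_halts_on; have Ha := computes_admissible.
(* The prefix serves only as a bound for the search, so the query can be put to the jump of the zero
   sequence, which is [0']. *)
pose R (z : (nat * (seq nat * seq nat)) * seq nat) := has (fun c =>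
  admissible (z.1, CodeSeq.decode c) && halts_on (z.1.1, CodeSeq.decode c))
    (iota 0 (size z.2)).
have [|||g Hg H] := @jump_query _ _ (fun x => (ufst x,
    (CodeSeq.decode (ufst (usnd x)), CodeSeq.decode (usnd (usnd x))))) R.
- by rewrite /R; computes_tac.
- by computes_tac.
- move=> [n [s l]]; rewrite [enc _]/(cpair n (cpair (enc s) (enc l))).
  rewrite ufst_cpair usnd_cpair ufst_cpair usnd_cpair /enc /enc_seq !map_id.
  by rewrite !CodeSeq.codeK.
have gP x :
  (halting_problem (g x) = 1 /\ exists t, admissible (x, t) && halts_on
    (x.1, t)) \/
  (halting_problem (g x) = 0 /\ forall t, ~~ (admissible (x, t) && halts_on
    (x.1, t))).
  have RE m : R (x, mkseq (fun=> 0) m) = has (fun c =>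
      admissible (x, CodeSeq.decode c) && halts_on (x.1, CodeSeq.decode c))
        (iota 0 m).
    by rewrite -[in RHS](size_mkseq (fun=> 0) m).
  case: (H (fun=> 0) x) => -[E h]; [left|right]; split=> //.
    by case: h => m; rewrite RE => /hasP[c _ ?]; exists (CodeSeq.decode c).
  move=> t; apply/negP => ht; have /negP[] := h (CodeSeq.code t).
  rewrite RE; apply/hasP; exists (CodeSeq.code t);
    last by rewrite CodeSeq.codeK.
  by rewrite mem_iota add0n ltnS leqnn.
(* Recovers the stage: the condition is in the last value of [b], and the values of [p] are at odd
   places of the oracle. At stage 0 the default 0 decodes to the empty condition. *)
pose X (z : seq nat * seq nat) := (size z.2, (CodeSeq.decode
  (usnd (last 0 z.2)),
  [seq nth 0 z.1 k.*2.+1 | k <- iota 0 (size z.2)])).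
(* The guards make sure that the oracle prefix contains the values of [p] used by [X] and the answer
   to the query, which is at an even place. *)
pose A (z : seq nat * seq nat) :=
  if ((size z.2).*2 <= size z.1) && ((g (X z)).*2 < size z.1)
  then omap (cpair (nth 0 z.1 (g (X z)).*2))
    (first_below (decides (X z) (nth 0 z.1 (g (X z)).*2)) (size z.1))
  else None.
exists A.
  have HX : computes X by rewrite /X; computes_tac.
  rewrite /A /decides; computes_tac; try apply: computes_cpair;
    try apply: computes_first_below;
    by computes_tac.
move=> p.
pose st n := stage p gP n.
pose b n := cpair (halting_problem (g (st n))) (extension gP (st n)).
exists (generic p gP), b.
pose q := bpair halting_problem p.
have q0 i : q i.*2 = halting_problem i by rewrite /q /bpair odd_double doubleK.
have q1 i : q i.*2.+1 = p i by rewrite /q /bpair /= odd_double uphalf_double.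
have XE m n : n.*2 <= m -> X (mkseq q m, mkseq b n) = st n.
  move=> nm; rewrite /X /st /stage /= size_mkseq; congr (_, (_, _)).
    case: n {nm} => [//|n].
    by rewrite mkseqS last_rcons /b usnd_cpair.
  rewrite /mkseq; apply/eq_in_map => k; rewrite mem_iota add0n => /andP[_ kn].
  by rewrite -/(mkseq q m) nth_mkseq ?q1 //; lia.
have AE m n : A (mkseq q m, mkseq b n) =
    if (n.*2 <= m) && ((g (st n)).*2 < m) then
      omap (cpair (halting_problem (g (st n))))
        (first_below (decides (st n) (halting_problem (g (st n)))) m)
    else None.
  rewrite /A [size _]size_mkseq [size _]size_mkseq; case: (leqP n.*2 m) =>
    //= nm.
  rewrite XE //; case: ifP => // gm.
  by rewrite nth_mkseq // q0.
split.
- exact: limit_generic.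
- by apply: funext => n; rewrite jump_generic /b ufst_cpair.
- move=> m n v; rewrite AE; case: ifP => // _.
  case E: (first_below _ _) => [c|] //= [<-]; congr cpair.
  have [dc cmin] := first_belowP E; rewrite /extension; case: ex_minnP =>
    c' dc' cmin'.
  by apply/eqP; rewrite eqn_leq cmin // cmin'.
- move=> n; exists (maxn n.*2 (maxn (g (st n)).*2 (extension gP (st n))).+1) =>
  m.
  rewrite !geq_max gtn_max => /and3P[nm gm cm]; rewrite AE nm gm /=.
  have : first_below (decides (st n) (halting_problem (g (st n)))) m.
    by apply: first_below_total cm; rewrite /extension; case: ex_minnP.
  by case: first_below.
Qed.

Theorem theorem3p2 (F : pfun baire baire) :
  computable_relative_to halting_problem F <->
  exists2 G : pfun baire baire,
    computable G & F = mcomp G jump_limit_inv :> mfun baire baire.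
Proof.
have JL p z : jump_limit_inv p z <-> exists2 r, limit r p & z = jump r.
  by split=> [[_ [r]]|[r lr ->]]; [exists r | split=> [r' _|];
    [exists (jump r') | exists r]].
split=> [[G [M HM] FG]|[G [M HM] FE]].
  have [A HA Ared] := jump_limit_reader.
  have [M' HM'] := transfer M HA (computes_id _).
  (* The domain consists only of the jumps of sequences whose limit is in the domain of [F]; this
     keeps the composition from being defined outside that domain. *)
  pose graph (z : baire) := [set y | exists r p,
    [/\ z = jump r, limit r p & F p y]]%classic.
  have single z : is_subset1 (graph z).
    move=> y y' [r [p [-> rp Fy]]] [r' [p' [/jump_inj E rp' Fy']]].
    rewrite -E in rp'; rewrite -(limit_unique rp rp') in Fy'.
    exact: pfun_single_valued Fy Fy'.
  exists (PFun single).
    exists M' => z y [r [p [-> rp Fy]]].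
    have [sound total] := Ared r p rp.
    apply: (HM' _ _ _ sound total); apply: HM; rewrite -FG //.
    by exists y.
  apply: funext => p; apply/seteqP; split=> y.
    move=> Fy; split=> [z /JL[r rp ->]|].
      by exists y, r, p.
    by have [r rp] := limit_surj p; exists (jump r);
      [apply/JL; exists r | exists r, p].
  move=> [_ [z /JL[r rp ->] [r' [p' [/jump_inj E rp' Fy]]]]].
  by rewrite -E in rp'; rewrite (limit_unique rp rp').
have [A HA Ared] := generic_reader.
have [M' HM'] := transfer M HA computes_ufst.
pose graph (z : baire) := [set y | exists2 p, z = bpair halting_problem p & F p
  y]%classic.
have inj p p' : bpair halting_problem p = bpair halting_problem p' -> p = p'.
  move=> E; apply: funext => i; have := congr1 (fun f : baire => f i.*2.+1) E.
  by rewrite /bpair /= odd_double uphalf_double.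
have single z : is_subset1 (graph z).
  by move=> y y' [p -> Fy] [p' /inj <- Fy']; exact: pfun_single_valued Fy Fy'.
exists (PFun single).
  exists M' => z y [p -> Fy].
  (* The equation for [F] puts all jumps of sequences with limit [p] into the domain of [G], with
     the same value; so it suffices to compute one of them. *)
  have [r [b [rp jE sound total]]] := Ared p.
  apply: (HM' _ _ _ sound total); rewrite -jE; apply: HM.
  have Hr : jump_limit_inv p (jump r) by apply/JL; exists r.
  have [dom _] : mcomp G jump_limit_inv p y by rewrite -FE.
  have [y' Gy'] := dom _ Hr.
  have Fy' : F p y' by rewrite FE; split=> //; exists (jump r).
  by rewrite (pfun_single_valued Fy Fy').
move=> p _; apply/seteqP; split=> y.
  by move=> Fy; exists p.
by move=> [p' /inj <-].
Qed.
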